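(* Let $\mathcal{H}$ be a well-behaved family of graphs and let $\Pi=$ \textsc{Independent Set}. Then the following are equivalent: (1) $\Pi$ admits an FPT-AS parameterized by $\mathbf{mod}_{\mathcal{H}}(\cdot)$ and $\epsilon$; (2) $\Pi$ admits an FPT-AS parameterized by $\mathbf{ed}_{\mathcal{H}}(\cdot)$ and $\epsilon$; (3) $\Pi$ admits an FPT-AS parameterized by $\mathbf{tw}_{\mathcal{H}}(\cdot)$ and $\epsilon$.
   Context: A family is well-behaved if hereditary and closed under disjoint union. \textsc{Independent Set}: find a maximum-size set of pairwise non-adjacent vertices. An FPT-AS parameterized by $p$ and $\epsilon$ returns an independent set of size at least $(1-\epsilon)\mathrm{OPT}$ in time $f(p,\epsilon)n^{O(1)}$, $f$ computable; by convention it is given a modulator / decomposition of size / depth / width equal to the parameter. $\mathbf{mod}_{\mathcal{H}}(G)$: minimum $|S|$ with $G-S\in\mathcal{H}$. $\mathcal{H}$-elimination decomposition $(T,\chi,L)$: $T$ rooted forest, $\chi:V(T)\to 2^{V(G)}$, $L\subseteq V(G)$; internal nodes have $|\chi(t)|\le1$, $\chi(t)\cap L=\emptyset$; bags partition $V(G)$; each leaf bag lies in $L$ and induces a graph of $\mathcal{H}$, leaf bags partition $L$; each edge joins bags of nodes in ancestor–descendant relation; $\mathbf{ed}_{\mathcal{H}}(G)$ = minimum depth (edges on a longest root-to-leaf path). $\mathcal{H}$-tree decomposition $(T,\chi,L)$: $T$ rooted tree; bags containing a vertex form a nonempty connected subtree; each edge in a bag; each $v\in L$ in the bag of a unique node,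 which is a leaf; for each leaf $t$, $G[\chi(t)\cap L]\in\mathcal{H}$; width $\max\{0,\max_t|\chi(t)\setminus L|-1\}$; $\mathbf{tw}_{\mathcal{H}}(G)$ = minimum width. *)

(* Defs.v *)
From HB Require Import structures.
From mathcomp Require Import all_boot all_order all_algebra.

Set Implicit Arguments.
Unset Strict Implicit.
Unset Printing Implicit Defensive.

Record sgraph := SGraph {
  vertex :> finType;
  edge : rel vertex;
  edge_sym : symmetric edge;
  edge_irr : irreflexive edge }.

Section Induced.
Variables (G : sgraph) (A : {set G}).

Definition ind_edge : rel {x : G | x \in A} :=
  fun x y => edge (val x) (val y).

Lemma ind_edge_sym : symmetric ind_edge.
Proof. by move=> x y; apply: edge_sym. Qed.

Lemma ind_edge_irr : irreflexive ind_edge.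
Proof. by move=> x; apply: edge_irr. Qed.

Definition induced : sgraph := SGraph ind_edge_sym ind_edge_irr.
End Induced.

Section DisjointUnion.
Variables G1 G2 : sgraph.

Definition union_edge : rel (G1 + G2)%type := fun x y =>
  match x, y with
  | inl u, inl v => edge u v
  | inr u, inr v => edge u v
  | _, _ => false
  end.

Lemma union_edge_sym : symmetric union_edge.
Proof. by move=> [x|x] [y|y] //=; apply: edge_sym. Qed.

Lemma union_edge_irr : irreflexive union_edge.
Proof. by move=> [x|x] /=; apply: edge_irr. Qed.

Definition disjoint_union : sgraph := SGraph union_edge_sym union_edge_irr.
End DisjointUnion.

Definition isomorphic (G1 G2 : sgraph) : Prop :=
  exists2 f : G1 -> G2, bijective f & forall x y, edge (f x) (f y) = edge x y.

Definition graph_family := sgraph -> Prop.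

(* As usual, a family of graphs does not depend on the names of the vertices,
   hence the first clause. *)
Definition well_behaved (H : graph_family) : Prop :=
  [/\ forall G1 G2, isomorphic G1 G2 -> H G1 -> H G2,
      forall (G : sgraph) (A : {set G}), H G -> H (induced A)
    & forall G1 G2, H G1 -> H G2 -> H (disjoint_union G1 G2)].

Definition independent (G : sgraph) (I : {set G}) : bool :=
  [forall x in I, forall y in I, ~~ edge x y].

Definition opt (G : sgraph) : nat := \max_(I : {set G} | independent I) #|I|.

Record forest := Forest {
  node :> finType;
  parent : node -> option node;
  parent_wf : forall t, exists k, iter k (obind parent) (Some t) = None }.

Definition is_root (F : forest) (t : F) : bool := parent t == None.

Definition is_leaf (F : forest) (t : F) : bool :=
  [forall s : F, parent s != Some t].

Definition is_tree (F : forest) : bool := #|[set t : F | is_root t]| == 1.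

(* Every node is an ancestor of itself. *)
Definition ancestor (F : forest) (a t : F) : bool :=
  connect [rel x y : F | parent x == Some y] t a.

(* The number of proper ancestors of t is the number of edges on the path
   from the root to t. *)
Definition node_depth (F : forest) (t : F) : nat :=
  #|[set a : F | ancestor a t & a != t]|.

Definition depth (F : forest) : nat := \max_(t : F | is_leaf t) node_depth t.

Definition tree_adj (F : forest) : rel F :=
  fun s t => (parent s == Some t) || (parent t == Some s).

Definition connected_in (F : forest) (X : {set F}) : Prop :=
  forall s t : F, s \in X -> t \in X ->
    connect [rel x y : F | [&& x \in X, y \in X & tree_adj x y]] s t.

(* The triples (T, chi, L). *)
Record decomposition (G : sgraph) := Decomposition {
  dforest :> forest;
  bag : dforest -> {set G};
  base : {set G} }.

Definition is_modulator (H : graph_family) (G : sgraph) (S : {set G}) : Prop :=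
  H (induced (~: S)).

(* Bags may be empty, so "partition" is meant for the indexed family of bags:
   each vertex is in the bag of exactly one node. *)
Definition is_elim_decomposition (H : graph_family) (G : sgraph)
    (D : decomposition G) : Prop :=
  [/\ forall t : D, ~~ is_leaf t ->
        #|bag t| <= 1 /\ [disjoint bag t & base D],
      forall v : G, exists! t : D, v \in bag t,
      forall t : D, is_leaf t -> bag t \subset base D /\ H (induced (bag t)),
      forall v : G, v \in base D -> exists! t : D, is_leaf t /\ v \in bag t
    & forall (u v : G) (s t : D), edge u v -> u \in bag s -> v \in bag t ->
        ancestor s t || ancestor t s].

Definition is_tree_decomposition (H : graph_family) (G : sgraph)
    (D : decomposition G) : Prop :=
  [/\ is_tree D,
      forall v : G, (exists t : D, v \in bag t) /\
        connected_in [set t : D | v \in bag t],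
      forall u v : G, edge u v ->
        exists t : D, u \in bag t /\ v \in bag t,
      forall v : G, v \in base D ->
        exists2 t : D, is_leaf t & forall s : D, (v \in bag s) = (s == t)
    & forall t : D, is_leaf t -> H (induced (bag t :&: base D))].

(* The truncated predecessor accounts for the outer max{0, _}. *)
Definition width (G : sgraph) (D : decomposition G) : nat :=
  (\max_(t : D) #|bag t :\: base D|).-1.

(* Model of computation: the weak call-by-value lambda-calculus with de Bruijn
   indices; time is the number of beta-steps.  This measure is polynomially
   related to Turing machine time (Dal Lago and Martini; Forster, Kunze and
   Roth), hence it yields the usual notions of computable function and of
   running time f(p, eps) * n^O(1). *)

Inductive term : Type :=
  | var of nat
  | app of term & term
  | lam of term.

(* Substitution is only used with a closed u, so no lifting is needed. *)
Fixpoint subst (s : term) (k : nat) (u : term) : term :=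
  match s with
  | var n => if n == k then u else var n
  | app s1 s2 => app (subst s1 k u) (subst s2 k u)
  | lam s1 => lam (subst s1 k.+1 u)
  end.

Fixpoint bound (k : nat) (s : term) : bool :=
  match s with
  | var n => n < k
  | app s1 s2 => bound k s1 && bound k s2
  | lam s1 => bound k.+1 s1
  end.

Definition closed_term (s : term) : bool := bound 0 s.

Fixpoint tsize (s : term) : nat :=
  match s with
  | var n => n.+1
  | app s1 s2 => (tsize s1 + tsize s2).+1
  | lam s1 => (tsize s1).+1
  end.

(* evals s k v: s reduces to the value v in k beta-steps. *)
Inductive evals : term -> nat -> term -> Prop :=
  | evals_lam s : evals (lam s) 0 (lam s)
  | evals_app s t s' t' v k1 k2 k3 :
      evals s k1 (lam s') -> evals t k2 (lam t') ->
      evals (subst s' 0 (lam t')) k3 v ->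
      evals (app s t) (k1 + k2 + k3).+1 v.

(* Scott encodings; numbers are in unary, which is harmless here since vertices
   and nodes are numbered from 0 and the encoding of eps is part of the
   parameter. *)

Definition enc_bool (b : bool) : term := lam (lam (var (if b then 1 else 0))).

Fixpoint enc_nat (n : nat) : term :=
  if n is n'.+1 then lam (lam (app (var 0) (enc_nat n')))
  else lam (lam (var 1)).

Definition enc_pair (a b : term) : term := lam (app (app (var 0) a) b).

Definition enc_option (T : Type) (enc : T -> term) (o : option T) : term :=
  if o is Some x then lam (lam (app (var 1) (enc x))) else lam (lam (var 0)).

Fixpoint enc_list (T : Type) (enc : T -> term) (s : seq T) : term :=
  if s is x :: s' then lam (lam (app (app (var 0) (enc x)) (enc_list enc s')))
  else lam (lam (var 1)).

Definition enc_elt (T : finType) (x : T) : term := enc_nat (enum_rank x).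

Definition enc_set (T : finType) (A : {set T}) : term :=
  enc_list (@enc_elt T) (enum A).

Definition enc_graph (G : sgraph) : term :=
  enc_list (fun x => enc_list (fun y => enc_bool (edge x y)) (enum G)) (enum G).

Definition enc_decomposition (G : sgraph) (D : decomposition G) : term :=
  enc_pair
    (enc_list (fun t : D =>
       enc_pair (enc_option (@enc_elt D) (parent t)) (enc_set (bag t)))
       (enum D))
    (enc_set (base D)).

Definition enc_rat (q : rat) : term :=
  enc_pair (enc_nat `|numq q|%N) (enc_nat `|denq q|%N).

Definition is_eps (eps : rat) : bool := (0 < eps < 1)%R.

Definition computable_bound (f : nat -> rat -> nat) : Prop :=
  exists2 F : term, closed_term F & forall (p : nat) (eps : rat), is_eps eps ->
    exists k, evals (app (app F (enc_nat p)) (enc_rat eps)) k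
                    (enc_nat (f p eps)).

(* A graph parameter defined as the least measure of a valid witness
   (a modulator or a decomposition) *)
Record parameter := GraphParam {
  witness : sgraph -> Type;
  wvalid : forall G, witness G -> Prop;
  wmeasure : forall G, witness G -> nat;
  enc_witness : forall G, witness G -> term }.

Definition param_value (P : parameter) (G : sgraph) (p : nat) : Prop :=
  (exists2 w : witness P G, wvalid w & wmeasure w = p) /\
  (forall w : witness P G, wvalid w -> p <= wmeasure w).

Definition mod_param (H : graph_family) : parameter :=
  @GraphParam (fun G => {set G}) (@is_modulator H)
    (fun G S => #|S|) (fun G => @enc_set G).

Definition ed_param (H : graph_family) : parameter :=
  @GraphParam decomposition (@is_elim_decomposition H)
    (fun G D => depth D) enc_decomposition.

Definition tw_param (H : graph_family) : parameter :=
  @GraphParam decomposition (@is_tree_decomposition H)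
    width enc_decomposition.

(* In the time bound, n is the size of the input (G, w): a decomposition may
   have many more nodes than G has vertices. *)
Definition independent_set_fptas (P : parameter) : Prop :=
  exists (A : term) (f : nat -> rat -> nat) (c : nat),
    [/\ closed_term A, computable_bound f &
      forall (G : sgraph) (w : witness P G) (p : nat) (eps : rat),
        param_value P G p -> wvalid w -> wmeasure w = p -> is_eps eps ->
        let n := tsize (enc_graph G) + tsize (enc_witness w) in
        exists (k : nat) (s : seq G),
          [/\ evals (app (app (app A (enc_graph G)) (enc_witness w))
                         (enc_rat eps))
                    k (enc_list (@enc_elt G) s),
              k <= f p eps * n ^ c,
              uniq s, independent [set x in s]
            & ((1 - eps) * (opt G)%:R <= (size s)%:R)%R]].

(* Main.v *)
(* All three schemes are equivalent to an efficient approximation scheme for the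
   graphs of H: a (1 - eps)-approximation in time f(eps) n^O(1).

   A graph of H has the empty modulator, and the decomposition with a single
   node, whose bag and base are the whole vertex set, has depth and width 0;
   hence each of the three schemes, run on these witnesses, approximates on H.

   Conversely, a tree decomposition (T, chi, L) is handled by dynamic
   programming: the table of a node t contains, for each independent X included
   in chi(t) \ L, an independent set of the graph below t that extends X; it
   consists of X, of the approximate solution on (chi(t) & L) \ N(X), which is a
   graph of H, and, for each child of t, of the largest entry of its table,
   restricted to the complement of chi(t) \ L, that has no edge to X.  A
   modulator S is turned into the decomposition with one node and base V \ S,
   and an elimination decomposition into a forest of bags by adding to each bag
   the bags of the ancestors of its node.

   All costs are polynomial in a single number N that bounds the numbers of
   vertices and nodes, 2^(p+1) and f(eps); with N = n * 2^(p+1) * (f(eps)+1),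
   a bound N^d splits as required. *)

From mathcomp Require Import all_boot all_order all_algebra zify.
From Stdlib Require Import Classical IndefiniteDescription.
Require Import Defs.

Set Implicit Arguments.
Unset Strict Implicit.
Unset Printing Implicit Defensive.

Import Order.TTheory GRing.Theory Num.Theory.

(** * The lambda-calculus *)

Coercion app : term >-> Funclass.

Definition is_lam (t : term) : bool := if t is lam _ then true else false.
Definition is_value (t : term) : bool := is_lam t && closed_term t.

Section Evaluation.
Implicit Types s t u v : term.

Lemma bound_leq k m t : k <= m -> bound k t -> bound m t.
Proof.
elim: t k m => [n|s IHs t IHt|s IHs] k m le_km /=.
- by move/leq_trans; apply.
- by move/andP=> [/(IHs _ _ le_km)-> /(IHt _ _ le_km)->].
- exact: IHs.
Qed.

Lemma bound_closed k t : closed_term t -> bound k t.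
Proof. exact: bound_leq. Qed.

Lemma subst_bound t k u : bound k t -> subst t k u = t.
Proof.
elim: t k => [n|s IHs t IHt|s IHs] k /=.
- by move=> lt_nk; rewrite ltn_eqF.
- by move/andP=> [/IHs-> /IHt->].
- by move/IHs->.
Qed.

Lemma subst_closed t k u : closed_term t -> subst t k u = t.
Proof. by move=> /(bound_closed k) /subst_bound. Qed.

Lemma value_closed t : is_value t -> closed_term t.
Proof. by case/andP. Qed.

Lemma evals_is_lam s k v : evals s k v -> is_lam v.
Proof. by elim. Qed.

Lemma evals_appP s t k v : evals (s t) k v ->
  exists s' t' k1 k2 k3, [/\ evals s k1 (lam s'), evals t k2 (lam t'),
    evals (subst s' 0 (lam t')) k3 v & k = (k1 + k2 + k3).+1].
Proof. by move=> ev; inversion ev; subst; do 5 eexists; split; eauto. Qed.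

Definition runs (s : term) (K : nat) (v : term) : Prop :=
  exists2 k, k <= K & evals s k v.

(* Evaluating s costs at most K more than evaluating s': unlike runs, this
   composes inside evaluation contexts. *)
Definition steps (s : term) (K : nat) (s' : term) : Prop :=
  forall K' v, runs s' K' v -> runs s (K + K') v.

Lemma runs_value v : is_value v -> runs v 0 v.
Proof. by case: v => // s _; exists 0 => //; constructor. Qed.

Lemma runs_leq s K K' v : runs s K v -> K <= K' -> runs s K' v.
Proof. by move=> [k le_k ev] le_K; exists k => //; apply: leq_trans le_K. Qed.

Lemma evals_runs s k v : evals s k v -> runs s k v.
Proof. by exists k. Qed.

Lemma runs_steps s K v : runs s K v -> steps s K v.
Proof.
move=> [k le_k ev] K' w [k' _ ev'].
have lam_v := evals_is_lam ev.
suff <- : v = w by exists k => //; apply: leq_trans le_k (leq_addr _ _).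
by case: v lam_v ev ev' => // b _ _ ev'; inversion ev'.
Qed.

Lemma steps_runs s K s' K' v : steps s K s' -> runs s' K' v -> runs s (K + K') v.
Proof. exact. Qed.

Lemma steps_trans s K s' K' s'' :
  steps s K s' -> steps s' K' s'' -> steps s (K + K') s''.
Proof. by move=> st st' L v r; rewrite -addnA; apply/st/st'. Qed.

Lemma steps_appl s K s' t : steps s K s' -> steps (s t) K (s' t).
Proof.
move=> st K' v [k le_k /evals_appP [b [u [k1 [k2 [k3 [ev1 ev2 ev3 def_k]]]]]]].
have [m le_m ev] := st _ _ (evals_runs ev1).
exists (m + k2 + k3).+1; first by lia.
exact: evals_app ev ev2 ev3.
Qed.

Lemma steps_appr s t K t' : steps t K t' -> steps (s t) K (s t').
Proof.
move=> st K' v [k le_k /evals_appP [b [u [k1 [k2 [k3 [ev1 ev2 ev3 def_k]]]]]]].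
have [m le_m ev] := st _ _ (evals_runs ev2).
exists (k1 + m + k3).+1; first by lia.
exact: evals_app ev1 ev ev3.
Qed.

Lemma steps_beta b u : is_value u -> steps ((lam b) u) 1 (subst b 0 u).
Proof.
case: u => // u _ K v [k le_k ev].
exists k.+1; first by rewrite add1n.
by have := evals_app (evals_lam b) (evals_lam u) ev; rewrite !add0n.
Qed.

Lemma steps_beta2 b s t : is_value s -> is_value t ->
  steps ((lam (lam b)) s t) 2 (subst (subst b 1 s) 0 t).
Proof.
move=> vs vt; apply: (@steps_trans _ 1 ((lam (subst b 1 s)) t) 1).
  exact/steps_appl/(@steps_beta (lam b)).
exact: steps_beta.
Qed.
End Evaluation.

(* Programs are written with Rocq binders: a term is a function of the number
   of binders above it, and a bound variable computes its own index. *)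
Definition hterm := nat -> term.
Definition hlam (f : hterm -> hterm) : hterm :=
  fun d => lam (f (fun d' => var (Nat.sub d' d.+1)) d.+1).
Definition happ (s t : hterm) : hterm := fun d => app (s d) (t d).
Definition hcst (t : term) : hterm := fun _ => t.
Coercion hcst : term >-> hterm.
Definition program (h : hterm) : term := h 0.

Notation "s $ t" := (happ s t) (at level 39, left associativity).
Notation "'fn' x .. y => t" := (hlam (fun x => .. (hlam (fun y => t)) ..))
  (at level 200, x binder, y binder, right associativity).

(** * Data and their encodings *)

Notation enc_elts := (enc_list (@enc_elt _)).
Notation value_encoding e := (forall x, is_value (e x)).

Lemma value_nat n : is_value (enc_nat n).
Proof.
case: n => [|n] //; rewrite /is_value /closed_term /=.
by elim: n => //= n /(bound_leq (leq_addl 2 2)).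
Qed.

Lemma value_bool b : is_value (enc_bool b).
Proof. by case: b. Qed.

Lemma value_pair a b : is_value a -> is_value b -> is_value (enc_pair a b).
Proof.
by move=> va vb; rewrite /is_value /closed_term /= !(bound_closed _ (value_closed _)).
Qed.

Lemma value_list T (e : T -> term) l :
  value_encoding e -> is_value (enc_list e l).
Proof.
move=> ve; elim: l => //= x l IHl; rewrite /is_value /closed_term /=.
by rewrite !(bound_closed _ (value_closed _)).
Qed.

Lemma value_option T (e : T -> term) o :
  value_encoding e -> is_value (enc_option e o).
Proof.
move=> ve; case: o => //= x; rewrite /is_value /closed_term /=.
by rewrite (bound_closed _ (value_closed _)).
Qed.

Lemma value_elt (T : finType) (x : T) : is_value (enc_elt x).
Proof. exact: value_nat. Qed.

Lemma enc_eltE (T : finType) (x : T) : enc_elt x = enc_nat (enum_rank x).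
Proof. by []. Qed.

Lemma enc_list_map T U (e : U -> term) (f : T -> U) l :
  enc_list e (map f l) = enc_list (fun x => e (f x)) l.
Proof. by elim: l => //= x l ->. Qed.

Lemma eq_enc_list T (e e' : T -> term) l : e =1 e' -> enc_list e l = enc_list e' l.
Proof. by move=> eq_e; elim: l => //= x l ->; rewrite eq_e. Qed.

Lemma enc_none T U (e : T -> term) (e' : U -> term) :
  enc_option e None = enc_option e' None.
Proof. by []. Qed.

Lemma tsize_bool b : tsize (enc_bool b) <= 4.
Proof. by case: b. Qed.

Lemma tsize_nat n : tsize (enc_nat n) = 4 * n + 4.
Proof. by elim: n => //= n ->; lia. Qed.

Lemma tsize_pair a b : tsize (enc_pair a b) = tsize a + tsize b + 4.
Proof. by rewrite /=; lia. Qed.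

Lemma tsize_none T (e : T -> term) : tsize (enc_option e None) = 3.
Proof. by []. Qed.

Lemma tsize_list T (e : T -> term) l :
  tsize (enc_list e l) = \sum_(x <- l) (tsize (e x) + 5) + 4.
Proof.
elim: l => [|x l IHl] /=; first by rewrite big_nil.
by rewrite big_cons IHl; lia.
Qed.

Lemma steps_bool b s t : is_value s -> is_value t ->
  steps ((enc_bool b) s t) 2 (if b then s else t).
Proof.
move=> vs vt; have := @steps_beta2 (var (if b then 1 else 0)) s t vs vt.
by case: b => //=; rewrite subst_closed ?value_closed.
Qed.

Lemma steps_pair a b f : is_value a -> is_value b -> is_value f ->
  steps ((enc_pair a b) f) 1 (f a b).
Proof.
move=> va vb vf; have := @steps_beta ((var 0) a b) f vf.
by rewrite /= !subst_closed ?value_closed.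
Qed.

Lemma steps_zero s t : is_value s -> is_value t -> steps ((enc_nat 0) s t) 2 s.
Proof. exact: (@steps_bool true). Qed.

Lemma steps_succ n s t : is_value s -> is_value t ->
  steps ((enc_nat n.+1) s t) 2 (t (enc_nat n)).
Proof.
move=> vs vt /=; move: (value_nat n); move: (enc_nat n) => m vm.
have := @steps_beta2 ((var 0) m) s t vs vt.
by rewrite /= !subst_closed ?value_closed.
Qed.

Section ContainerEliminators.
Variables (X : Type) (e : X -> term).

Lemma steps_nil s t : is_value s -> is_value t -> steps ((enc_list e [::]) s t) 2 s.
Proof. exact: (@steps_bool true). Qed.

Lemma steps_cons x l s t : value_encoding e -> is_value s -> is_value t ->
  steps ((enc_list e (x :: l)) s t) 2 (t (e x) (enc_list e l)).
Proof.
move=> ve vs vt /=; move: (value_list l ve); move: (enc_list e l) => m vm.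
have := @steps_beta2 ((var 0) (e x) m) s t vs vt.
by rewrite /= !subst_closed ?value_closed.
Qed.

Lemma steps_none s t : is_value s -> is_value t -> steps ((enc_option e None) s t) 2 t.
Proof. exact: (@steps_bool false). Qed.

Lemma steps_some x s t : value_encoding e -> is_value s -> is_value t ->
  steps ((enc_option e (Some x)) s t) 2 (s (e x)).
Proof.
move=> ve vs vt; have := @steps_beta2 ((var 1) (e x)) s t vs vt.
by rewrite /= !subst_closed ?value_closed.
Qed.
End ContainerEliminators.

(** * Symbolic execution *)

Create HintDb val.

Ltac value_tac :=
  lazymatch goal with
  | |- forall _, _ => intro; cbv beta; value_tac
  | |- is_true (is_value (enc_nat _)) => apply: value_nat
  | |- is_true (is_value (enc_bool _)) => apply: value_bool
  | |- is_true (is_value (enc_elt _)) => apply: value_elt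
  | |- is_true (is_value (enc_pair _ _)) => apply: value_pair; value_tac
  | |- is_true (is_value (enc_list _ _)) => apply: value_list; value_tac
  | |- is_true (is_value (enc_option _ _)) => apply: value_option; value_tac
  | |- is_true (is_value (lam _)) => rewrite /is_value /closed_term /=; bound_tac
  | |- is_true (is_value (app _ _)) => fail
  | |- is_true (is_value _) =>
      solve [assumption | auto 3 with val | eauto 2 | vm_compute; reflexivity]
  end
with bound_tac :=
  lazymatch goal with
  | |- is_true (_ && _) => apply/andP; split; bound_tac
  | |- is_true (bound _ _) => apply: bound_closed; closed_tac
  | |- _ => done
  end
with closed_tac :=
  first [assumption | apply: value_closed; value_tac].

Ltac subst_tac :=
  simpl;
  repeat match goal with
  | |- context [subst ?t ?k ?u] =>
      rewrite (@subst_closed t k u); [ | closed_tac ]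
  end.

Ltac in_context tac :=
  first [ tac tt | apply: steps_appr; in_context tac
        | apply: steps_appl; in_context tac ].

Ltac beta := eapply steps_runs;
  [ in_context ltac:(fun _ => lazymatch goal with |- steps (app (lam _) _) _ _ =>
      eapply steps_beta; value_tac end) | subst_tac ].
Ltac betas := repeat beta.
Ltac expose := cbv [program hlam happ hcst Nat.sub].
Ltac ret := apply: runs_value; value_tac.

(* [execute P] runs the program P up to its first call, and leaves the time
   bound as its last goal; [step], [call] and [finish] then use a lemma on steps,
   on a run whose value is used further, and on the final run. *)
Tactic Notation "execute" := eapply runs_leq; [ betas | ].
Tactic Notation "execute" constr(P) := eapply runs_leq; [ unfold P; expose; betas | ].

Tactic Notation "finish" uconstr(lem) :=
  eapply lem;
  lazymatch goal with
  | |- is_true (is_value _) => value_tac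
  | |- forall _, is_true (is_value _) => value_tac
  | |- _ => try first [eassumption | done]
  end.
Tactic Notation "step" uconstr(lem) := eapply steps_runs;
  [ in_context ltac:(fun _ => finish lem) | betas ].
Tactic Notation "call" uconstr(lem) := eapply steps_runs;
  [ in_context ltac:(fun _ => eapply runs_steps; finish lem) | betas ].

Definition Nil : term := lam (lam (var 1)).
Definition Cons : term := program (fn x l n c => c $ x $ l).
Definition Pair : term := program (fn a b f => f $ a $ b).
Definition Just : term := program (fn x s n => s $ x).
Definition Succ : term := program (fn n z s => s $ n).

Lemma enc_nil X (e : X -> term) : Nil = enc_list e [::]. Proof. by []. Qed.

Lemma cons_runs X (e : X -> term) x l : value_encoding e ->
  runs (Cons (e x) (enc_list e l)) 2 (enc_list e (x :: l)).
Proof.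
move=> ve; move: (value_list l ve) (value_list (x :: l) ve) => /=.
move: (enc_list e l) => m vm vxm; execute Cons; first exact: runs_value.
by [].
Qed.

Lemma pair_runs a b : is_value a -> is_value b ->
  runs (Pair a b) 2 (enc_pair a b).
Proof.
move=> va vb; execute Pair; first by apply: runs_value; apply: value_pair.
by [].
Qed.

Lemma just_runs X (e : X -> term) x : value_encoding e ->
  runs (Just (e x)) 1 (enc_option e (Some x)).
Proof.
move=> ve; have := value_option (Some x) ve => /= vs.
execute Just; first exact: runs_value.
by [].
Qed.

Lemma succ_runs n : runs (Succ (enc_nat n)) 1 (enc_nat n.+1).
Proof.
move: (value_nat n) (value_nat n.+1) => /=; move: (enc_nat n) => m vm vSm.
execute Succ; first exact: runs_value.
by [].
Qed.

(* Opaque, so that [simpl] in [subst_tac] takes programs and encodings as constants. *)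
#[global] Opaque Nil Cons Pair Just Succ.
#[global] Opaque enc_nat enc_bool enc_pair enc_list enc_option enc_elt.

Definition Not : term := program (fn b => b $ enc_bool false $ enc_bool true).

Lemma not_runs b : runs (Not (enc_bool b)) 3 (enc_bool (~~ b)).
Proof. by execute Not; first by step steps_bool; case: b; ret. Qed.
#[global] Opaque Not.

(** * Recursion *)

(* The call-by-value fixed point: the recursive call is [Fix F] itself, since
   [Fix F] is the term [fn y => w $ w $ y] for [w := Fix_self F]. *)
Definition Fix_self (F : term) : term :=
  program (fn w x => F $ (fn y => w $ w $ y) $ x).
Definition Fix (F : term) : term :=
  program (fn x => Fix_self F $ Fix_self F $ x).

Lemma value_Fix_self F : is_value F -> is_value (Fix_self F).
Proof. by move=> vF; rewrite /Fix_self; expose; value_tac. Qed.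
#[export] Hint Resolve value_Fix_self : val.

Lemma value_Fix F : is_value F -> is_value (Fix F).
Proof. by move=> vF; rewrite /Fix; expose; value_tac. Qed.
#[export] Hint Resolve value_Fix : val.

Lemma steps_Fix F x : is_value F -> is_value x ->
  steps (Fix F x) 3 (F (Fix F) x).
Proof.
move=> vF vx K v r; have vS := value_Fix_self vF.
suff: runs (Fix F x) (1 + (1 + (1 + K))) v by [].
rewrite /Fix in r *; move: r; rewrite /Fix_self in vS *; expose => r.
by beta; beta; beta.
Qed.
#[global] Opaque Fix_self Fix.

Definition Foldr_step : term := program
  (fn r f a l => l $ a $ (fn x xs => f $ x $ (r $ f $ a $ xs))).
Definition Foldr : term := Fix Foldr_step.

Definition Iter_step : term := program
  (fn r f a n => n $ a $ (fn m => f $ (r $ f $ a $ m))).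
Definition Iter : term := Fix Iter_step.

Definition loop_time (N K : nat) := N * (K + 12) + 12.

Section Foldr.
Variables (X : eqType) (Y : Type) (eX : X -> term) (eY : Y -> term).
Implicit Types (g : X -> Y -> Y) (y : Y) (l : seq X).

Lemma foldr_runs_suffix f g l K N y0 :
  value_encoding eX -> value_encoding eY -> is_value f ->
  size l <= N ->
  (forall l1 x l2, l = l1 ++ x :: l2 ->
     runs (f (eX x) (eY (foldr g y0 l2))) K (eY (g x (foldr g y0 l2)))) ->
  runs (Foldr f (eY y0) (enc_list eX l)) (loop_time N K) (eY (foldr g y0 l)).
Proof.
move=> veX veY vf leN fP; apply: (@runs_leq _ (size l * (K + 12) + 12)); last first.
  by rewrite leq_add2r leq_mul.
rewrite /Foldr; elim: l fP {leN} => [|x l IHl] fP.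
  by execute; first by step steps_Fix; unfold Foldr_step; expose; betas;
    step steps_nil; ret.
have {}IHl := IHl (fun l1 x' l2 eq_l => fP (x :: l1) x' l2 (f_equal (cons x) eq_l)).
execute.
  step steps_Fix; rewrite {1}/Foldr_step; expose; betas; step steps_cons.
  by call IHl; apply: fP [::] _ _ (erefl _).
by rewrite /=; lia.
Qed.

Lemma foldr_runs f g l K N y0 :
  value_encoding eX -> value_encoding eY -> is_value f ->
  size l <= N ->
  (forall x y, x \in l -> runs (f (eX x) (eY y)) K (eY (g x y))) ->
  runs (Foldr f (eY y0) (enc_list eX l)) (loop_time N K) (eY (foldr g y0 l)).
Proof.
move=> veX veY vf leN fP; apply: foldr_runs_suffix => // l1 x l2 eq_l.
by apply: fP; rewrite eq_l mem_cat mem_head orbT.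
Qed.
End Foldr.

Section Iter.
Variables (Y : Type) (eY : Y -> term).

Lemma iter_runs_sum f g (K : Y -> nat) n y0 :
  value_encoding eY -> is_value f ->
  (forall y, runs (f (eY y)) (K y) (eY (g y))) ->
  runs (Iter f (eY y0) (enc_nat n))
    (\sum_(i < n) (K (iter i g y0) + 12) + 12) (eY (iter n g y0)).
Proof.
move=> veY vf fP; rewrite /Iter; elim: n => [|n IHn]; execute.
- by step steps_Fix; unfold Iter_step; expose; betas; step steps_zero; ret.
- by rewrite big_ord0.
- step steps_Fix; rewrite {1}/Iter_step; expose; betas; step steps_succ.
  by call IHn; apply: fP.
by rewrite big_ord_recr /=; lia.
Qed.

Lemma iter_runs f g n K N y0 :
  value_encoding eY -> is_value f -> n <= N ->
  (forall y, runs (f (eY y)) K (eY (g y))) ->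
  runs (Iter f (eY y0) (enc_nat n)) (loop_time N K) (eY (iter n g y0)).
Proof.
move=> veY vf leN fP; apply: runs_leq (iter_runs_sum n y0 veY vf fP) _.
by rewrite sum_nat_const card_ord /loop_time leq_add2r leq_mul.
Qed.
End Iter.
#[global] Opaque Foldr Iter.

(** * Programs on lists *)

Definition Map : term := program
  (fn f l => Foldr $ (fn x acc => Cons $ (f $ x) $ acc) $ Nil $ l).
Definition Filter : term := program
  (fn p l => Foldr $ (fn x acc => (p $ x) $ (Cons $ x $ acc) $ acc) $ Nil $ l).
Definition All : term := program
  (fn p l => Foldr $ (fn x acc => (p $ x) $ acc $ enc_bool false) $ enc_bool true $ l).
Definition Cat : term := program (fn l1 l2 => Foldr $ Cons $ l2 $ l1).
Definition Flatten : term := program (fn ls => Foldr $ Cat $ Nil $ ls).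
Definition Tail : term := program (fn l => l $ Nil $ (fn x xs => xs)).
Definition Isnil : term := program
  (fn l => l $ enc_bool true $ (fn x xs => enc_bool false)).
Definition Shorter : term := program
  (fn l1 l2 => Isnil $ (Foldr $ (fn x acc => Tail $ acc) $ l1 $ l2)).
Definition Longest : term := program
  (fn ls => Foldr $ (fn l acc => Shorter $ l $ acc $ acc $ l) $ Nil $ ls).
Definition Subseqs : term := program
  (fn l => Foldr $ (fn x acc => Cat $ acc $ (Map $ (fn y => Cons $ x $ y) $ acc))
             $ (Cons $ Nil $ Nil) $ l).
Definition Nth : term := program
  (fn l i => (Iter $ Tail $ l $ i) $ Nil $ (fn x xs => x)).
Definition Indices : term := program
  (fn l => Foldr $ (fn x acc => Cons $ enc_nat 0 $ (Map $ Succ $ acc)) $ Nil $ l).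

Definition list_time (N K : nat) := loop_time N (K + 10) + 10.
Definition cat_time N := loop_time N 10 + 10.
Definition flatten_time N := list_time N (cat_time N).
Definition shorter_time N := loop_time N 10 + 10.
Definition longest_time N := list_time N (shorter_time N).
Definition subseqs_time N := loop_time N (list_time N 10 + cat_time N + 10) + 10.
Definition nth_time N := loop_time N 10 + 10.
Definition indices_time N := loop_time N (list_time N 10 + 10) + 10.

Definition longest (X : Type) (ls : seq (seq X)) : seq X :=
  foldr (fun l acc => if size l <= size acc then acc else l) [::] ls.

Lemma longest_mem (X : eqType) (ls : seq (seq X)) :
  longest ls = [::] \/ longest ls \in ls.
Proof.
elim: ls => [|l ls IHls] /=; first by left.
case: ifP => _; last by right; rewrite mem_head.
by case: IHls => [->|m]; [left | right; rewrite inE m orbT].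
Qed.

Lemma size_longest (X : eqType) (ls : seq (seq X)) l :
  l \in ls -> size l <= size (longest ls).
Proof.
elim: ls => //= l' ls IHls; rewrite inE => /orP[/eqP<-|/IHls].
  by case: ifP.
by case: ifP => // /negbT; rewrite -ltnNge => lt_s /leq_trans; apply; apply: ltnW.
Qed.

Fixpoint subseqs (X : Type) (l : seq X) : seq (seq X) :=
  if l is x :: l' then subseqs l' ++ map (cons x) (subseqs l') else [:: [::]].

Lemma size_subseqs (X : Type) (l : seq X) : size (subseqs l) = 2 ^ size l.
Proof. by elim: l => //= x l IHl; rewrite size_cat size_map IHl expnS; lia. Qed.

Lemma filter_subseqs (X : eqType) (p : pred X) (l : seq X) : filter p l \in subseqs l.
Proof.
elim: l => //= x l IHl; rewrite mem_cat; case: (p x); last by rewrite IHl.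
by rewrite map_f ?orbT.
Qed.

Lemma mem_subseqs (X : eqType) (l l' : seq X) : l' \in subseqs l -> subseq l' l.
Proof.
elim: l l' => [|x l IHl] l' /=; first by rewrite inE => /eqP->.
rewrite mem_cat => /orP[/IHl sl|/mapP[l'' /IHl sl ->]].
  exact: subseq_trans sl (subseq_cons _ _).
by rewrite /= eqxx.
Qed.

Lemma size_filter_leq (X : Type) (p : pred X) (l : seq X) : size (filter p l) <= size l.
Proof. by rewrite size_filter count_size. Qed.

Lemma drop_iter_behead (X : Type) i (l : seq X) : iter i behead l = drop i l.
Proof. by elim: i => [|i /= ->]; rewrite ?drop0 // -drop1 drop_drop add1n. Qed.

Section ListPrograms.
Variables (X : eqType) (eX : X -> term).
Local Notation eL := (enc_list eX).

Lemma map_enc_runs f e l K N :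
  value_encoding eX -> value_encoding e -> is_value f ->
  size l <= N -> (forall x, x \in l -> runs (f (eX x)) K (e x)) ->
  runs (Map f (eL l)) (list_time N K) (enc_list e l).
Proof.
move=> veX ve vf leN fP.
have {2}-> : l = foldr cons [::] l by elim: (l) => //= x l' <-.
execute Map.
  rewrite (enc_nil e); finish (foldr_runs (K := K + 10)) => x y xl.
  by execute; [call (fP x xl); finish cons_runs | lia].
by rewrite /list_time; lia.
Qed.

Lemma map_runs (Y : Type) (eY : Y -> term) f g l K N :
  value_encoding eX -> value_encoding eY -> is_value f ->
  size l <= N -> (forall x, x \in l -> runs (f (eX x)) K (eY (g x))) ->
  runs (Map f (eL l)) (list_time N K) (enc_list eY (map g l)).
Proof. by move=> veX veY vf leN fP; rewrite enc_list_map; apply: map_enc_runs. Qed.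

Lemma filter_runs f p l K N :
  value_encoding eX -> is_value f -> size l <= N ->
  (forall x, x \in l -> runs (f (eX x)) K (enc_bool (p x))) ->
  runs (Filter f (eL l)) (list_time N K) (eL (filter p l)).
Proof.
move=> veX vf leN fP; execute Filter.
  rewrite (enc_nil eX).
  finish (foldr_runs (K := K + 10) (g := fun x acc => if p x then x :: acc else acc)).
  move=> x y xl; execute.
    by call (fP x xl); call (cons_runs (e := eX) x y); step steps_bool; case: (p x); ret.
  by lia.
by rewrite /list_time; lia.
Qed.

Lemma all_runs f p l K N :
  value_encoding eX -> is_value f -> size l <= N ->
  (forall x, x \in l -> runs (f (eX x)) K (enc_bool (p x))) ->
  runs (All f (eL l)) (list_time N K) (enc_bool (all p l)).
Proof.
move=> veX vf leN fP; execute All.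
  finish (foldr_runs (K := K + 10) (g := fun x acc => p x && acc) true) => x y xl.
  by execute; [call (fP x xl); step steps_bool; case: (p x); ret | lia].
by rewrite /list_time; lia.
Qed.

Lemma cat_runs l1 l2 N : value_encoding eX -> size l1 <= N ->
  runs (Cat (eL l1) (eL l2)) (cat_time N) (eL (l1 ++ l2)).
Proof.
move=> veX leN; have -> : l1 ++ l2 = foldr cons l2 l1 by elim: (l1) => //= x l ->.
execute Cat.
  by finish (foldr_runs (K := 10)) => x y _; apply: runs_leq (cons_runs _ _ _) _.
by rewrite /cat_time; lia.
Qed.
End ListPrograms.
#[global] Opaque Map Filter All Cat.

Section MoreListPrograms.
Variables (X : eqType) (eX : X -> term).
Local Notation eL := (enc_list eX).

Lemma flatten_runs ls N : value_encoding eX ->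
  size ls <= N -> all (fun l => size l <= N) ls ->
  runs (Flatten (enc_list eL ls)) (flatten_time N) (eL (flatten ls)).
Proof.
move=> veX leN /allP lesN; execute Flatten.
  rewrite (enc_nil eX); finish (foldr_runs (K := cat_time N) (g := cat)) => l y /lesN le_l.
  by finish cat_runs.
by rewrite /flatten_time /list_time /loop_time; lia.
Qed.

Lemma tail_runs l : value_encoding eX ->
  runs (Tail (eL l)) 5 (eL (behead l)).
Proof.
move=> veX; case: l => [|x l]; execute Tail.
- by step steps_nil; rewrite -(enc_nil eX); ret.
- by [].
- by step steps_cons; ret.
by [].
Qed.
#[local] Opaque Tail.

Lemma isnil_runs l : value_encoding eX ->
  runs (Isnil (eL l)) 5 (enc_bool (nilp l)).
Proof.
move=> veX; case: l => [|x l]; execute Isnil.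
- by step steps_nil; ret.
- by [].
- by step steps_cons; ret.
by [].
Qed.
#[local] Opaque Isnil.

Lemma shorter_runs l1 l2 N : value_encoding eX -> size l2 <= N ->
  runs (Shorter (eL l1) (eL l2)) (shorter_time N) (enc_bool (size l1 <= size l2)).
Proof.
move=> veX leN; execute Shorter.
  call (foldr_runs (K := 10) (g := fun=> behead)).
    by move=> x y _; execute; [finish tail_runs |].
  have -> : foldr (fun=> behead) l1 l2 = drop (size l2) l1.
    by rewrite -drop_iter_behead; elim: (l2) => //= _ l ->.
  by rewrite -subn_eq0 -size_drop; finish isnil_runs.
by rewrite /shorter_time; lia.
Qed.
#[local] Opaque Shorter.

Lemma longest_runs ls N : value_encoding eX ->
  size ls <= N -> all (fun l => size l <= N) ls ->
  runs (Longest (enc_list eL ls)) (longest_time N) (eL (longest ls)).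
Proof.
move=> veX leN /allP lesN; execute Longest.
  rewrite (enc_nil eX); finish (foldr_runs_suffix (K := shorter_time N + 10)
    (g := fun l acc => if size l <= size acc then acc else l)).
  move=> ls1 l ls2 eq_ls; rewrite -/(longest ls2).
  have leL : size (longest ls2) <= N.
    have [->//|m] := longest_mem ls2.
    by apply: lesN; rewrite eq_ls mem_cat inE m !orbT.
  execute.
    by call (shorter_runs l veX leL); step steps_bool; case: ifP => _; ret.
  by lia.
by rewrite /longest_time /list_time; lia.
Qed.

Lemma subseqs_runs l N : value_encoding eX -> size l <= N -> 2 ^ size l <= N ->
  runs (Subseqs (eL l)) (subseqs_time N) (enc_list eL (subseqs l)).
Proof.
move=> veX leN le2N; execute Subseqs.
  rewrite {1}(enc_nil eX) (enc_nil eL).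
  call (cons_runs (e := eL) [::] [::]).
  pose g x (acc : seq (seq X)) := acc ++ map (cons x) acc.
  have subseqsE l' : foldr g [:: [::]] l' = subseqs l' by elim: l' => //= x l' ->.
  rewrite -subseqsE; finish (foldr_runs_suffix (K := list_time N 10 + cat_time N + 10)).
  move=> l1 x l2 eq_l; rewrite subseqsE /g.
  have leS : size (subseqs l2) <= N.
    by apply: leq_trans le2N; rewrite size_subseqs leq_pexp2l // eq_l size_cat /=; lia.
  execute.
    call (map_runs (g := cons x) (eY := eL) (K := 10)).
      by move=> y _; execute; [finish cons_runs |].
    by finish cat_runs.
  by lia.
by rewrite /subseqs_time; lia.
Qed.

Lemma nth_runs x0 l i N : value_encoding eX -> i < size l -> size l <= N ->
  runs (Nth (eL l) (enc_nat i)) (nth_time N) (eX (nth x0 l i)).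
Proof.
move=> veX lt_i leN; execute Nth.
  call (iter_runs (g := behead) (K := 10) (N := N)).
      exact: leq_trans (ltnW lt_i) leN.
    by move=> y; apply: runs_leq (tail_runs y veX) _.
  by rewrite drop_iter_behead (drop_nth x0 lt_i); step steps_cons; ret.
by rewrite /nth_time; lia.
Qed.

Lemma indices_runs l N : value_encoding eX -> size l <= N ->
  runs (Indices (eL l)) (indices_time N) (enc_list enc_nat (iota 0 (size l))).
Proof.
move=> veX leN; execute Indices.
  pose g (x : X) acc := 0 :: map S acc.
  have iotaE l' : foldr g [::] l' = iota 0 (size l').
    by elim: l' => //= x l' ->; rewrite /g -(iotaDl 1).
  rewrite -iotaE (enc_nil enc_nat).
  finish (foldr_runs_suffix (K := list_time N 10 + 10)).
  move=> l1 x l2 eq_l; rewrite iotaE /g.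
  execute.
    call (map_runs (g := S) (eY := enc_nat) (K := 10) (N := N)).
        by rewrite size_iota; apply: leq_trans leN; rewrite eq_l size_cat /=; lia.
      by move=> y _; apply: runs_leq (succ_runs y) _.
    by finish cons_runs.
  by lia.
by rewrite /indices_time; lia.
Qed.
End MoreListPrograms.
#[global] Opaque Flatten Tail Isnil Shorter Longest Subseqs Nth Indices.

(** * Programs on numbers and on elements of finite types *)

Definition Pred : term := program (fn n => n $ enc_nat 0 $ (fn m => m)).
Definition Iszero : term := program
  (fn n => n $ enc_bool true $ (fn m => enc_bool false)).
Definition Eqn : term := program
  (fn m n => (Iszero $ (Iter $ Pred $ m $ n))
               $ (Iszero $ (Iter $ Pred $ n $ m)) $ enc_bool false).
Definition Mem : term := program
  (fn x l => Not $ (All $ (fn y => Not $ (Eqn $ x $ y)) $ l)).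
Definition Restrict : term := program (fn l s => Filter $ (fn x => Mem $ x $ l) $ s).
Definition Remove : term := program (fn l s => Filter $ (fn x => Not $ (Mem $ x $ l)) $ s).
Definition Eq_option : term := program (fn o p =>
  o $ (fn i => p $ (fn j => Eqn $ j $ i) $ enc_bool false)
    $ (p $ (fn j => enc_bool false) $ enc_bool true)).
Definition Add : term := program (fn m n => Iter $ Succ $ n $ m).
Definition Mul : term := program (fn m n => Iter $ (fn x => Add $ m $ x) $ enc_nat 0 $ n).
Definition Exp : term := program (fn m n => Iter $ (fn x => Mul $ m $ x) $ enc_nat 1 $ n).

Definition eqn_time N := loop_time N 10 + loop_time N 10 + 20.
Definition mem_time N := list_time N (eqn_time N + 10) + 10.
Definition restrict_time N := list_time N (mem_time N + 10) + 10.
Definition add_time m := loop_time m 1 + 2.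
Definition mul_time m n := loop_time n (add_time m + 1) + 2.

Lemma pred_runs n : runs (Pred (enc_nat n)) 5 (enc_nat n.-1).
Proof.
case: n => [|n]; execute Pred.
- by step steps_zero; ret.
- by [].
- by step steps_succ; ret.
by [].
Qed.
#[global] Opaque Pred.

Lemma iszero_runs n : runs (Iszero (enc_nat n)) 5 (enc_bool (n == 0)).
Proof.
case: n => [|n]; execute Iszero.
- by step steps_zero; ret.
- by [].
- by step steps_succ; ret.
by [].
Qed.
#[global] Opaque Iszero.

Lemma sub_runs m n N : n <= N ->
  runs (Iter Pred (enc_nat m) (enc_nat n)) (loop_time N 10) (enc_nat (m - n)).
Proof.
move=> leN; have -> : m - n = iter n predn m.
  by elim: n {leN} => [|n /= <-]; rewrite ?subn0 // subnS.
by finish iter_runs => y; apply: runs_leq (pred_runs y) _.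
Qed.

Lemma eqn_runs m n N : m <= N -> n <= N ->
  runs (Eqn (enc_nat m) (enc_nat n)) (eqn_time N) (enc_bool (m == n)).
Proof.
move=> lemN lenN; execute Eqn.
  call (sub_runs n lemN); call (sub_runs m lenN).
  call (iszero_runs (n - m)); call (iszero_runs (m - n)); step steps_bool.
  by rewrite !subn_eq0 eqn_leq; case: (m <= n); ret.
by rewrite /eqn_time; lia.
Qed.
#[global] Opaque Eqn.

Lemma add_runs m n :
  runs (Add (enc_nat m) (enc_nat n)) (add_time m) (enc_nat (m + n)).
Proof.
execute Add.
  have -> : m + n = iter m S n by elim: m => //= m <-.
  by finish (iter_runs (K := 1) (N := m)) => x; apply: succ_runs.
by rewrite /add_time; lia.
Qed.
#[global] Opaque Add.

Lemma mul_runs m n :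
  runs (Mul (enc_nat m) (enc_nat n)) (mul_time m n) (enc_nat (m * n)).
Proof.
execute Mul.
  have -> : m * n = iter n (addn m) 0 by rewrite iter_addn_0.
  finish (iter_runs (K := add_time m + 1) (N := n)) => x.
  by execute; [finish add_runs | lia].
by rewrite /mul_time; lia.
Qed.
#[global] Opaque Mul.

Lemma exp_runs m n : exists K,
  runs (Exp (enc_nat m) (enc_nat n)) K (enc_nat (m ^ n)).
Proof.
eexists; execute Exp; last exact: leqnn.
have -> : m ^ n = iter n (muln m) 1 by elim: n => // n; rewrite expnS => ->.
finish (iter_runs_sum (K := fun x => mul_time m x + 1) n 1) => x.
by execute; [finish mul_runs | lia].
Qed.
#[global] Opaque Exp.

Lemma size_uniq_leq (T : finType) (l : seq T) N : #|T| <= N -> uniq l -> size l <= N.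
Proof. by move=> leN /card_uniqP <-; apply: leq_trans (max_card _) leN. Qed.

Lemma size_enum_leq (T : finType) (A : {set T}) N : #|T| <= N -> size (enum A) <= N.
Proof. by move=> leN; apply: size_uniq_leq (enum_uniq _). Qed.

Section ElementPrograms.
Variables (T : finType) (N : nat).
Hypothesis leTN : #|T| <= N.

Lemma eq_elt_runs (x y : T) :
  runs (Eqn (enc_elt x) (enc_elt y)) (eqn_time N) (enc_bool (x == y)).
Proof.
rewrite !enc_eltE -(inj_eq enum_rank_inj); apply: eqn_runs.
  exact: leq_trans (ltnW (ltn_ord _)) leTN.
exact: leq_trans (ltnW (ltn_ord _)) leTN.
Qed.

Lemma mem_runs (x : T) l : size l <= N ->
  runs (Mem (enc_elt x) (enc_elts l)) (mem_time N) (enc_bool (x \in l)).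
Proof.
move=> leN; execute Mem.
  call (all_runs (p := fun y => x != y) (K := eqn_time N + 10)).
    by move=> y _; execute; [call eq_elt_runs; apply: not_runs | lia].
  have -> : x \in l = ~~ all (fun y => x != y) l.
    by rewrite -has_predC -has_pred1; apply: eq_has => y /=; rewrite negbK eq_sym.
  exact: not_runs.
by rewrite /mem_time; lia.
Qed.

#[local] Opaque Mem.

Lemma restrict_runs (l s : seq T) : size l <= N -> size s <= N ->
  runs (Restrict (enc_elts l) (enc_elts s)) (restrict_time N)
    (enc_elts [seq x <- s | x \in l]).
Proof.
move=> leN leS; execute Restrict.
  finish (filter_runs (K := mem_time N + 10)) => x _.
  by execute; [finish mem_runs | lia].
by rewrite /restrict_time; lia.
Qed.

Lemma remove_runs (l s : seq T) : size l <= N -> size s <= N ->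
  runs (Remove (enc_elts l) (enc_elts s)) (restrict_time N)
    (enc_elts [seq x <- s | x \notin l]).
Proof.
move=> leN leS; execute Remove.
  finish (filter_runs (K := mem_time N + 10)) => x _.
  by execute; [call mem_runs; apply: not_runs | lia].
by rewrite /restrict_time; lia.
Qed.

Lemma eq_option_runs (o p : option T) :
  runs (Eq_option (enc_option (@enc_elt T) o) (enc_option (@enc_elt T) p))
    (eqn_time N + 20) (enc_bool (p == o)).
Proof.
case: p => [y|]; case: o => [x|]; execute Eq_option.
- by step steps_some; step steps_some; step steps_some; apply: eq_elt_runs.
- by lia.
- by step steps_some; step steps_none; ret.
- by lia.
- by step steps_none; step steps_some; step steps_none; ret.
- by lia.
- by step steps_none; step steps_none; ret.
by lia.
Qed.

Lemma enc_enum : enc_list enc_nat (iota 0 #|T|) = enc_elts (enum T).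
Proof.
have -> : iota 0 #|T| = map (fun x : T => val (enum_rank x)) (enum T).
  apply: (@eq_from_nth _ 0) => [|i]; rewrite size_iota; first by rewrite size_map -cardE.
  move=> lt_i; have x0 : T := enum_val (Ordinal lt_i).
  rewrite nth_iota // (nth_map x0) -?cardE // add0n.
  by rewrite -[i]/(val (Ordinal lt_i)) -enum_val_nth enum_valK.
by rewrite enc_list_map.
Qed.

Lemma enum_runs (e : T -> term) : value_encoding e ->
  runs (Indices (enc_list e (enum T))) (indices_time N) (enc_elts (enum T)).
Proof. by move=> ve; rewrite -enc_enum cardE; apply: indices_runs; rewrite // -cardE. Qed.

Lemma nth_enum_runs (e : T -> term) (x : T) : value_encoding e ->
  runs (Nth (enc_list e (enum T)) (enc_elt x)) (nth_time N) (e x).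
Proof.
move=> ve; rewrite enc_eltE -{2}(nth_enum_rank x x).
by apply: nth_runs; rewrite // -cardE.
Qed.
End ElementPrograms.
#[global] Opaque Mem Restrict Remove Eq_option.

(** * Forests *)

Section ForestTheory.
Variable F : forest.
Implicit Types (a b r s t : F).

Definition climb k t : option F := iter k (obind (@parent F)) (Some t).

Lemma climbS k t : climb k.+1 t = obind (@parent F) (climb k t).
Proof. by []. Qed.

Lemma climbD m k t : climb (m + k) t = obind (climb m) (climb k t).
Proof. by rewrite /climb iterD; case: (iter k _ _) => //=; elim: m => //= m ->. Qed.

Lemma climbSr k t : climb k.+1 t = obind (climb k) (parent t).
Proof. by rewrite -addn1 climbD. Qed.

Lemma ancestorP a t : reflect (exists k, climb k t = Some a) (ancestor a t).
Proof.
apply: (iffP idP) => [|[k]].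
  case/connectP=> p; elim: p t => [|s p IHp] t /=; first by move=> _ ->; exists 0.
  case/andP=> /eqP par_t /IHp{}IHp /IHp[k def_a].
  by exists k.+1; rewrite climbSr par_t.
elim: k t => [|k IHk] t; first by case=> ->; apply: connect0.
rewrite climbSr; case par_t: (parent t) => [s|] //= /IHk.
by apply: connect_trans; apply: connect1; rewrite /= par_t.
Qed.

Lemma ancestor_refl t : ancestor t t. Proof. exact: connect0. Qed.

Lemma ancestor_trans a s t : ancestor a s -> ancestor s t -> ancestor a t.
Proof. by move=> anc_s anc_t; apply: connect_trans anc_t anc_s. Qed.

Lemma ancestor_parent s t : parent s = Some t -> ancestor t s.
Proof. by move=> par_s; apply: connect1; rewrite /= par_s. Qed.

Lemma ancestor_cases a s : ancestor a s ->
  a = s \/ exists2 t, parent s = Some t & ancestor a t.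
Proof.
case/ancestorP=> -[[->]|k]; first by left.
rewrite climbSr; case par_s: (parent s) => [t|] //= up_t.
by right; exists t => //; apply/ancestorP; exists k.
Qed.

Lemma climb_acyclic k t : climb k.+1 t != Some t.
Proof.
apply/eqP=> cyc; have [m up_m] : exists m, climb m t = None := parent_wf t.
have cycM j : climb (j * k.+1) t = Some t.
  by elim: j => // j IHj; rewrite mulSn climbD IHj.
by have := cycM m; rewrite mulnS addnC climbD up_m.
Qed.

Lemma ancestor_parentN s t : parent s = Some t -> ~~ ancestor s t.
Proof.
move=> par_s; apply/negP=> /ancestorP[k up_k].
by have /eqP[] := climb_acyclic k s; rewrite climbSr par_s.
Qed.

Lemma ancestor_comparable a b r :
  ancestor a r -> ancestor b r -> ancestor a b \/ ancestor b a.
Proof.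
have anc_leq a' b' k k' : k <= k' ->
    climb k r = Some a' -> climb k' r = Some b' -> ancestor b' a'.
  move=> /subnK <- up_k; rewrite climbD up_k => up_b.
  by apply/ancestorP; exists (k' - k).
move=> /ancestorP[k up_k] /ancestorP[k' up_k'].
have [le_k|/ltnW le_k] := leqP k k'; first by right; apply: (anc_leq a b k k').
by left; apply: (anc_leq b a k' k).
Qed.

Lemma sibling_descendants s s' r : parent s = parent s' ->
  ancestor s r -> ancestor s' r -> s = s'.
Proof.
move=> par_s; have above a b : parent a = parent b -> ancestor a b -> a = b.
  move=> par_a /ancestor_cases[//|[t par_b anc_t]]; rewrite par_b in par_a.
  by have := ancestor_parentN par_a; rewrite anc_t.
by move=> anc_s anc_s'; have [/above|/above] := ancestor_comparable anc_s anc_s' => ->.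
Qed.

Lemma connected_descendants a : connected_in [set t | ancestor a t].
Proof.
set adj := fun s t => [&& s \in [set t | ancestor a t], t \in [set t | ancestor a t]
                        & tree_adj s t].
have sym_adj : connect_sym adj.
  by apply: sym_connect_sym => s t; rewrite /adj /tree_adj andbCA [_ || _]orbC.
have connect_top t : ancestor a t -> connect adj t a.
  case/ancestorP=> k; elim: k t => [|k IHk] t; first by case=> ->; apply: connect0.
  rewrite climbSr; case par_t: (parent t) => [s|] //= up_s.
  apply: connect_trans (IHk s up_s); apply: connect1; rewrite /adj /tree_adj par_t eqxx.
  have anc_s : ancestor a s by apply/ancestorP; exists k.
  by rewrite !inE anc_s (ancestor_trans anc_s (ancestor_parent par_t)).
move=> s t; rewrite !inE => /connect_top s_a /connect_top t_a.
by apply: connect_trans s_a _; rewrite sym_adj.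
Qed.

Lemma climb_leq_card t : exists2 k, k <= #|F| & climb k t = None.
Proof.
have [m up_m] := parent_wf t.
have to_None : fconnect (obind (@parent F)) (Some t) None by rewrite -up_m fconnect_iter.
exists (findex (obind (@parent F)) (Some t) None); last exact: iter_findex.
rewrite -ltnS -card_option; apply: leq_trans (findex_max to_None) _.
exact: max_card.
Qed.

Lemma climb_lt_card k s t : climb k t = Some s -> k < #|F|.
Proof.
have [m le_m up_m] := climb_leq_card t => up_k; apply: leq_trans le_m; rewrite ltnNge.
by apply/negP=> le_mk; rewrite -(subnK le_mk) climbD up_m in up_k.
Qed.

Lemma root_above t : exists2 s, parent s = None & ancestor s t.
Proof.
have [k _] := climb_leq_card t; elim: k => // k IHk; rewrite climbS.
case def_s: (climb k t) => [s|] /= => [root_s|_]; last exact: IHk.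
by exists s => //; apply/ancestorP; exists k.
Qed.

Lemma node_depth_parent s t : parent s = Some t -> node_depth t < node_depth s.
Proof.
move=> par_s; apply: proper_card; apply/properP; split.
  apply/subsetP=> a; rewrite !inE => /andP[anc_a neq_a].
  rewrite (ancestor_trans anc_a (ancestor_parent par_s)).
  by apply: contraTneq anc_a => ->; apply: ancestor_parentN.
exists t; rewrite !inE ?eqxx ?andbF // ancestor_parent //=.
by apply/eqP=> eq_ts; have := ancestor_parentN par_s; rewrite eq_ts ancestor_refl.
Qed.

Lemma leaf_below t : exists2 l : F, is_leaf l & node_depth t <= node_depth l.
Proof.
case: (@arg_maxnP _ t (fun=> true) (@node_depth F)) => // l _ l_max.
exists l; last exact: l_max.
apply/forallP=> s; apply/eqP=> par_s.
by have := l_max s isT; rewrite /geq /= leqNgt node_depth_parent.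
Qed.

Lemma node_depth_leq t : node_depth t <= depth F.
Proof.
have [l leaf_l le_l] := leaf_below t; apply: leq_trans le_l _.
exact: (leq_bigmax_cond _ leaf_l).
Qed.

Lemma leaf_descendant (l r : F) : is_leaf l -> ancestor l r -> r = l.
Proof.
move=> leaf_l /ancestorP[[[]//|k]]; rewrite climbS.
by case: (climb k r) => //= s /eqP; rewrite (negPf (forallP leaf_l s)).
Qed.

End ForestTheory.

(** * Forest decompositions *)

Lemma width_leqP (G : sgraph) (D : decomposition G) p :
  reflect (forall t : D, #|bag t :\: base D| <= p.+1) (width D <= p).
Proof.
rewrite /width -subn1 leq_subLR add1n.
by apply: (iffP (bigmax_leqP _ _ _)) => leB t *; apply: leB.
Qed.

Section ForestDecomposition.
Variables (H : graph_family) (G : sgraph) (D : decomposition G).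

(* The conditions of a tree decomposition that do not mention roots and leaves. *)
Record is_forest_decomposition : Prop := ForestDecomposition {
  fd_cover : forall v : G, exists t : D, v \in bag t;
  fd_connected : forall v : G, connected_in [set t : D | v \in bag t];
  fd_edge : forall u v : G, edge u v -> exists t : D, u \in bag t /\ v \in bag t;
  fd_base : forall (v : G) (s t : D),
    v \in base D -> v \in bag s -> v \in bag t -> s = t;
  fd_family : forall t : D, H (induced (bag t :&: base D)) }.

Definition obag (o : option D) : {set G} := if o is Some t then bag t else set0.
Definition below (t : D) : {set G} := \bigcup_(r : D | ancestor t r) bag r.
Definition strictly_below (s : D) : {set G} := below s :\: obag (parent s).

Lemma belowP t v : reflect (exists2 r : D, ancestor t r & v \in bag r) (v \in below t).
Proof. exact: bigcupP. Qed.

Lemma bag_below t : bag t \subset below t.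
Proof. by apply: bigcup_sup (ancestor_refl t). Qed.

Lemma below_parent s t : parent s = Some t -> below s \subset below t.
Proof.
move=> par_s; apply/bigcupsP=> r anc_r; apply: bigcup_sup.
exact: ancestor_trans (ancestor_parent par_s) anc_r.
Qed.

Hypothesis fdD : is_forest_decomposition.

(* The only edge of the forest leaving the subtree of s is the one to its parent. *)
Lemma subtree_closed s v : (v \notin bag s) || (v \notin obag (parent s)) ->
  forall r r' : D, ancestor s r -> v \in bag r -> v \in bag r' -> ancestor s r'.
Proof.
move=> v_out r r' anc_r vr vr'.
have same_side x y : v \in bag x -> v \in bag y -> parent x = Some y ->
    ancestor s x = ancestor s y.
  move=> vx vy par_x; apply/idP/idP; last first.
    by move=> anc; apply: ancestor_trans anc (ancestor_parent par_x).
  case/ancestor_cases=> [eq_sx|[z]]; last by rewrite par_x => -[<-].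
  by move: v_out; rewrite eq_sx par_x /= vx vy.
have clos : closed [rel x y : D | [&& x \in [set t : D | v \in bag t],
    y \in [set t : D | v \in bag t] & tree_adj x y]] [pred x | ancestor s x].
  move=> x y /= /and3P[]; rewrite !inE => vx vy /orP[] /eqP par; first exact: same_side.
  by apply/esym; apply: same_side.
by have := closed_connect clos (@fd_connected fdD v r r' _ _); rewrite !inE => <-.
Qed.

Lemma below_obag s v : v \in below s -> v \in obag (parent s) -> v \in bag s.
Proof.
case/belowP=> r anc_r vr; case par_s: (parent s) => [t|] /=; last by rewrite inE.
move=> vt; apply: contraT => vs; have /negP[] := ancestor_parentN par_s.
by apply: subtree_closed anc_r vr vt; rewrite vs.
Qed.

Lemma strictly_below_bag s r v : v \in strictly_below s -> v \in bag r -> ancestor s r.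
Proof.
case/setDP=> /belowP[r' anc_r' vr'] vs; apply: subtree_closed anc_r' vr'.
by rewrite vs orbT.
Qed.

Lemma strictly_below_neighbour s u v : v \in strictly_below s -> edge u v -> u \in below s.
Proof.
move=> vs /(fd_edge fdD)[r [ur vr]]; apply/belowP; exists r => //.
exact: strictly_below_bag vs vr.
Qed.

Lemma strictly_below_sibling s s' v w : parent s = parent s' ->
  v \in strictly_below s -> w \in strictly_below s' -> v = w \/ edge v w -> s = s'.
Proof.
move=> par_s vs ws' vw.
have [r [vr wr]] : exists r : D, v \in bag r /\ w \in bag r.
  by case: vw => [<-|/(fd_edge fdD)//]; have [r vr] := fd_cover fdD v; exists r.
apply: (@sibling_descendants _ _ _ r) => //.
  exact: strictly_below_bag vs vr.
exact: strictly_below_bag ws' wr.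
Qed.

Lemma base_neighbour (t : D) v w : v \in base D -> v \in bag t -> edge v w -> w \in bag t.
Proof. by move=> vb vt /(fd_edge fdD)[r [vr wr]]; rewrite (fd_base fdD vb vt vr). Qed.

Lemma below_base_notin s v : v \in below s -> v \in base D -> v \notin obag (parent s).
Proof.
case/belowP=> r anc_r vr vb; case par_s: (parent s) => [t|] /=; rewrite ?inE //.
apply/negP=> vt; by have := ancestor_parentN par_s; rewrite -(fd_base fdD vb vr vt) anc_r.
Qed.

End ForestDecomposition.

(** * Approximate independent sets *)

Definition frac_leq (a : rat) (m n : nat) : bool := (a * m%:R <= n%:R)%R.

Section FracLeq.
Variable a : rat.
Hypotheses (a_ge0 : (0 <= a)%R) (a_le1 : (a <= 1)%R).

Lemma frac_leq0 n : frac_leq a 0 n.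
Proof. by rewrite /frac_leq mulr0 ler0n. Qed.

Lemma frac_leqW m n : m <= n -> frac_leq a m n.
Proof.
move=> le_mn; apply: (@le_trans _ _ m%:R%R); last by rewrite ler_nat.
by rewrite ler_piMl // ler0n.
Qed.

Lemma frac_leq_transl m m' n : m <= m' -> frac_leq a m' n -> frac_leq a m n.
Proof. by move=> le_m; apply: le_trans; rewrite ler_wpM2l // ler_nat. Qed.

Lemma frac_leq_transr m n n' : frac_leq a m n -> n <= n' -> frac_leq a m n'.
Proof. by move=> le_mn le_n; apply: le_trans le_mn _; rewrite ler_nat. Qed.

Lemma frac_leqD m n m' n' :
  frac_leq a m n -> frac_leq a m' n' -> frac_leq a (m + m') (n + n').
Proof. by rewrite /frac_leq !natrD mulrDr; apply: lerD. Qed.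

Lemma frac_leq_sum (I : finType) (P : pred I) (f g : I -> nat) :
  (forall i, P i -> frac_leq a (f i) (g i)) ->
  frac_leq a (\sum_(i | P i) f i) (\sum_(i | P i) g i).
Proof.
by move=> le_fg; apply: (@big_ind2 _ _ (frac_leq a)) le_fg;
  [exact: frac_leq0 | exact: frac_leqD].
Qed.
End FracLeq.

Section Stable.
Variable G : sgraph.
Implicit Types (X Y s : seq G) (I : {set G}).

Definition nonadj X (v : G) : bool := all (fun x => ~~ edge x v) X.
Definition stable X : bool := all (nonadj X) X.

Lemma nonadjP X v : reflect {in X, forall x, ~~ edge x v} (nonadj X v).
Proof. exact: allP. Qed.

Lemma all_nonadjP X Y : reflect {in X & Y, forall x y, ~~ edge x y} (all (nonadj X) Y).
Proof.
apply: (iffP allP) => [XY x y xX /XY/nonadjP|XY y yY]; first exact.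
by apply/nonadjP=> x xX; apply: XY.
Qed.

Lemma stableP X : reflect {in X &, forall x y, ~~ edge x y} (stable X).
Proof. exact: all_nonadjP. Qed.

Lemma stable_cat X Y : stable (X ++ Y) = [&& stable X, stable Y & all (nonadj X) Y].
Proof.
apply/stableP/and3P => [XY|[/stableP XX /stableP YY /all_nonadjP XY] x y].
  by split; [apply/stableP|apply/stableP|apply/all_nonadjP] => x y xX yY;
    apply: XY; rewrite mem_cat ?xX ?yY ?orbT.
rewrite !mem_cat => /orP[xX|xY] /orP[yX|yY]; [exact: XX | exact: XY | | exact: YY].
by rewrite edge_sym XY.
Qed.

Lemma sub_stable X Y : {subset X <= Y} -> stable Y -> stable X.
Proof. by move=> sXY /stableP YY; apply/stableP=> x y /sXY xY /sXY; apply: YY. Qed.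

Lemma independentP I : reflect {in I &, forall x y, ~~ edge x y} (independent I).
Proof.
apply: (iffP forall_inP) => [indI x y xI|indI x xI]; first exact: (forall_inP (indI x xI)).
by apply/forall_inP=> y; apply: indI.
Qed.

Lemma independent_stable X : independent [set x in X] = stable X.
Proof. by apply/independentP/stableP=> indX x y; have := indX x y; rewrite !inE. Qed.

Lemma opt_attained : exists2 I : {set G}, independent I & opt G = #|I|.
Proof.
have ind0 : independent (set0 : {set G}) by apply/independentP=> x; rewrite inE.
have [I indI max_I] := eq_bigmax_cond (fun I : {set G} => #|I|)
  (introT card_gt0P (ex_intro _ set0 ind0)).
by exists I; last exact: max_I.
Qed.

Definition approx_in (a : rat) (U : {pred G}) s : Prop :=
  [/\ uniq s, {subset s <= U}, stable s &
      forall I, independent I -> {subset I <= U} -> frac_leq a #|I| (size s)].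

Definition approximates (a : rat) s : Prop :=
  [/\ uniq s, independent [set x in s] & (a * (opt G)%:R <= (size s)%:R)%R].

Lemma approx_in_approximates a s : approx_in a predT s -> approximates a s.
Proof.
move=> [uniq_s _ stable_s opt_s]; split=> //; first by rewrite independent_stable.
by have [I indI ->] := opt_attained; apply: opt_s.
Qed.
End Stable.

(** * The dynamic program *)

Lemma uniq_flatten_map (I X : eqType) (f : I -> seq X) (l : seq I) :
  uniq l -> {in l, forall i, uniq (f i)} ->
  {in l &, forall i j x, x \in f i -> x \in f j -> i = j} ->
  uniq (flatten (map f l)).
Proof.
elim: l => //= i l IHl /andP[il ul] uf inj_f; rewrite cat_uniq uf ?mem_head //=.
rewrite IHl // => [|j jl|j k jl kl]; first last.
- by apply: inj_f; rewrite inE ?jl ?kl orbT.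
- by apply: uf; rewrite inE jl orbT.
rewrite andbT; apply/hasPn=> x /flatten_mapP[j jl xj]; apply/negP=> xi.
have eq_ij : i = j by apply: inj_f xi xj; rewrite ?mem_head // inE jl orbT.
by rewrite eq_ij jl in il.
Qed.

Lemma card_bigcup_leq (I T : finType) (P : pred I) (A : I -> {set T}) :
  #|\bigcup_(i | P i) A i| <= \sum_(i | P i) #|A i|.
Proof.
apply: (big_ind2 (fun (B : {set T}) n => #|B| <= n)) => //; first by rewrite cards0.
move=> B m C n leB leC; rewrite cardsU; apply: leq_trans (leq_subr _ _) _.
exact: leq_add.
Qed.

Section CoreAndBase.
Variables (G : sgraph) (D : decomposition G).
Implicit Types (t : D) (o : option D).

Definition core t : seq G := [seq v <- enum (bag t) | v \notin base D].
Definition base_part t : seq G := [seq v <- enum (bag t) | v \in base D].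
Definition ocore o : seq G := if o is Some t then core t else [::].

Lemma mem_core t v : (v \in core t) = (v \in bag t) && (v \notin base D).
Proof. by rewrite mem_filter mem_enum andbC. Qed.

Lemma mem_ocore o v : (v \in ocore o) = (v \in obag o) && (v \notin base D).
Proof. by case: o => [t|] /=; rewrite ?mem_core // inE. Qed.

Lemma mem_base_part t v : (v \in base_part t) = (v \in bag t) && (v \in base D).
Proof. by rewrite mem_filter mem_enum andbC. Qed.

Lemma uniq_core t : uniq (core t).
Proof. exact/filter_uniq/enum_uniq. Qed.

Lemma uniq_base_part t : uniq (base_part t).
Proof. exact/filter_uniq/enum_uniq. Qed.

Lemma size_core t : size (core t) = #|bag t :\: base D|.
Proof.
rewrite -(card_uniqP (uniq_core t)); apply: eq_card => v.
by rewrite mem_core !inE andbC.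
Qed.
End CoreAndBase.

Section DynamicProgram.
Variables (G : sgraph) (D : decomposition G) (sol : seq G -> seq G).
Implicit Types (X B F : seq G) (s t : D) (o : option D).

(* In a list of nodes with their tables, the table of t has one entry for each
   independent X included in the core of t: an independent set of the graph
   below t whose trace on the core is X. *)

Definition best_entry X B (tb : seq (seq G)) : seq G :=
  longest [seq F <- [seq [seq v <- F | v \notin B] | F <- tb] | all (nonadj X) F].

Definition best_entries X B (sts : seq (D * seq (seq G))) : seq G :=
  flatten [seq best_entry X B st.2 | st <- sts].

Definition children o (sts : seq (D * seq (seq G))) : seq (D * seq (seq G)) :=
  [seq st <- sts | parent st.1 == o].

Definition extend sts t X : seq G :=
  X ++ sol [seq v <- base_part t | nonadj X v]
    ++ best_entries X (core t) (children (Some t) sts).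

Definition update sts t : seq (seq G) :=
  [seq extend sts t X | X <- subseqs (core t) & stable X].

Fixpoint table (i : nat) t : seq (seq G) :=
  if i is j.+1 then update [seq (s, table j s) | s <- enum D] t else [::].

Definition states i := [seq (t, table i t) | t <- enum D].

Definition children_solution i o X : seq G :=
  best_entries X (ocore o) (children o (states i)).

Definition dp_solution : seq G := children_solution #|D| None [::].

Lemma update_states i : [seq (st.1, update (states i) st.1) | st <- states i] = states i.+1.
Proof. by rewrite -map_comp. Qed.

Lemma children_solutionE i o X : children_solution i o X =
  flatten [seq best_entry X (ocore o) (table i s) | s <- enum D & parent s == o].
Proof. by rewrite /children_solution /best_entries /children filter_map -map_comp. Qed.

Lemma tableS i t : table i.+1 t =
  [seq X ++ sol [seq v <- base_part t | nonadj X v] ++ children_solution i (Some t) X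
  | X <- subseqs (core t) & stable X].
Proof. by []. Qed.

Lemma size_table i t : size (table i t) <= 2 ^ size (core t).
Proof.
case: i => // i; rewrite tableS size_map.
by apply: leq_trans (size_filter_leq _ _) _; rewrite size_subseqs.
Qed.

Lemma best_entryP X B tb : best_entry X B tb = [::] \/
  exists2 F, F \in tb & best_entry X B tb = [seq v <- F | v \notin B] /\
    all (nonadj X) (best_entry X B tb).
Proof.
rewrite /best_entry; set ls := filter _ _; case: (longest_mem ls) => [->|]; first by left.
by rewrite {1}mem_filter => /andP[nX /mapP[F Ftb eqF]]; right; exists F; rewrite -?eqF.
Qed.

Variables (H : graph_family) (a : rat).
Hypotheses (fdD : is_forest_decomposition H D) (a_ge0 : (0 <= a)%R) (a_le1 : (a <= 1)%R).
Hypothesis solP : forall t (U : seq G),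
  uniq U -> {subset U <= base_part t} -> approx_in a [in U] (sol U).

Definition sound t F : Prop := [/\ uniq F, {subset F <= below t} & stable F].

Definition below_children o : {set G} :=
  \bigcup_(s : D | parent s == o) strictly_below s.

Lemma strictly_below_filter s F : {subset F <= below s} ->
  {subset [seq v <- F | v \notin ocore (parent s)] <= strictly_below s}.
Proof.
move=> sF v; rewrite mem_filter mem_ocore negb_and negbK => /andP[v_out /sF v_below].
rewrite inE v_below andbT; case/orP: v_out => // vb.
exact: (below_base_notin fdD v_below vb).
Qed.

Lemma below_children_below t v :
  v \in below_children (Some t) -> (v \notin bag t) && (v \in below t).
Proof.
case/bigcupP=> s /eqP par_s; rewrite inE par_s => /andP[-> vs] /=.
exact: subsetP (below_parent par_s) v vs.
Qed.

Lemma best_entry_sound s X tb : (forall F, F \in tb -> sound s F) ->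
  let K := best_entry X (ocore (parent s)) tb in
  [/\ uniq K, {subset K <= strictly_below s}, stable K & all (nonadj X) K].
Proof.
move=> snd_tb /=; case: (best_entryP X (ocore (parent s)) tb) => [-> //|].
case=> F /snd_tb[uF bF stF] [-> nX]; split=> //.
- exact: filter_uniq.
- exact: strictly_below_filter.
by apply: sub_stable stF => v; rewrite mem_filter => /andP[].
Qed.

(* Distinct children have disjoint and non-adjacent strictly_below. *)
Lemma flatten_children_sound o (f : D -> seq G) :
  (forall s, parent s = o ->
     [/\ uniq (f s), {subset f s <= strictly_below s} & stable (f s)]) ->
  let K := flatten [seq f s | s <- enum D & parent s == o] in
  [/\ uniq K, {subset K <= below_children o} & stable K].
Proof.
move=> fP; have parE s : s \in [seq s <- enum D | parent s == o] -> parent s = o.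
  by rewrite mem_filter => /andP[/eqP].
have fb s v : parent s = o -> v \in f s -> v \in strictly_below s.
  by move=> /fP[_ sub_f _] /sub_f.
split.
- apply: uniq_flatten_map; first exact/filter_uniq/enum_uniq.
    by move=> s /parE/fP[].
  move=> s s' /parE par_s /parE par_s' v vs vs'.
  apply: (strictly_below_sibling fdD (etrans par_s (esym par_s')) (fb s v par_s vs)).
    exact: fb par_s' vs'.
  by left.
- move=> v /flatten_mapP[s /parE par_s vs]; apply/bigcupP; exists s; first exact/eqP.
  exact: fb.
apply/stableP=> v w /flatten_mapP[s /parE par_s vs] /flatten_mapP[s' /parE par_s' ws'].
apply/negP=> vw; have eq_ss' : s = s'.
  apply: (strictly_below_sibling fdD (etrans par_s (esym par_s')) (fb s v par_s vs)).
    exact: fb par_s' ws'.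
  by right.
have [_ _ /stableP st_s] := fP s par_s.
by have := st_s v w vs; rewrite eq_ss' vw => /(_ ws').
Qed.

Lemma children_solution_sound i o X : (forall t F, F \in table i t -> sound t F) ->
  let K := children_solution i o X in
  [/\ uniq K, {subset K <= below_children o}, stable K & all (nonadj X) K].
Proof.
move=> snd_i; rewrite /= children_solutionE.
have bestP s := @best_entry_sound s X (table i s) (snd_i s).
have [|uK sK stK] := flatten_children_sound (o := o)
  (f := fun s => best_entry X (ocore o) (table i s)).
  by move=> s par_s; case: (bestP s); rewrite par_s.
split=> //; apply/allP=> v /flatten_mapP[s]; rewrite mem_filter => /andP[/eqP par_s _].
by case: (bestP s); rewrite par_s => _ _ _ /allP; apply.
Qed.

Lemma extend_sound t X S K :
  [/\ uniq X, {subset X <= core t} & stable X] ->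
  [/\ uniq S, {subset S <= base_part t}, stable S & all (nonadj X) S] ->
  [/\ uniq K, {subset K <= below_children (Some t)}, stable K & all (nonadj X) K] ->
  sound t (X ++ S ++ K).
Proof.
move=> [uX sX stX] [uS sS stS nXS] [uK sK stK nXK]; split.
- rewrite !cat_uniq uX uS uK has_cat negb_or /= andbT -andbA; apply/and3P; split;
    apply/hasPn=> v.
  + by move/sS; rewrite mem_base_part => /andP[_ vb]; apply/negP=> /sX;
      rewrite mem_core vb andbF.
  + by move/sK/below_children_below=> /andP[/negPf vt _]; apply/negP=> /sX;
      rewrite mem_core vt.
  by move/sK/below_children_below=> /andP[/negPf vt _]; apply/negP=> /sS;
    rewrite mem_base_part vt.
- move=> v; rewrite !mem_cat; case/or3P=> [/sX|/sS|/sK/below_children_below/andP[]//].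
    by rewrite mem_core => /andP[vt _]; apply: subsetP (bag_below t) v vt.
  by rewrite mem_base_part => /andP[vt _]; apply: subsetP (bag_below t) v vt.
rewrite !stable_cat stX stS stK all_cat nXS nXK !andbT /=.
apply/all_nonadjP=> v w /sS; rewrite mem_base_part => /andP[vt vb].
move=> /sK/below_children_below/andP[wt _]; apply: contra wt.
exact: base_neighbour fdD _ _ _ vb vt.
Qed.

Lemma base_oracle t X : let S := sol [seq v <- base_part t | nonadj X v] in
  [/\ uniq S, {subset S <= base_part t}, stable S & all (nonadj X) S].
Proof.
set U := filter _ _; have sU v : v \in U -> (v \in base_part t) && nonadj X v.
  by rewrite mem_filter andbC.
have [] := @solP t U (filter_uniq _ (uniq_base_part t)); first by move=> v /sU/andP[].
move=> uS sS stS _; split=> // [v /sS/sU/andP[]//|].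
by apply/allP=> v /sS/sU/andP[].
Qed.

Lemma table_sound i t F : F \in table i t -> sound t F.
Proof.
elim: i t F => // i IHi t F; rewrite tableS => /mapP[X].
rewrite mem_filter => /andP[stX /mem_subseqs sX] ->{F}.
apply: extend_sound; last exact: children_solution_sound.
  by split=> //; [exact: subseq_uniq sX (uniq_core t) | exact: mem_subseq].
exact: base_oracle.
Qed.

Fixpoint reach (i : nat) t : {set G} :=
  if i is j.+1 then bag t :|: \bigcup_(s | parent s == Some t) reach j s else set0.

Section Completeness.
Variable I : {set G}.
Hypothesis indI : independent I.

Definition trace o : seq G := [seq v <- ocore o | v \in I].

Definition matches i t F : Prop :=
  {in core t, forall v, (v \in F) = (v \in I)} /\
  frac_leq a #|I :&: (reach i t :\: (bag t :\: base D))|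
             (size [seq v <- F | v \notin core t]).

Lemma mem_trace o v : (v \in trace o) = (v \in I) && (v \in ocore o).
Proof. by rewrite mem_filter. Qed.

Lemma stable_trace o : stable (trace o).
Proof.
apply/stableP=> x y; rewrite !mem_trace => /andP[xI _] /andP[yI _].
exact: (independentP _ indI).
Qed.

Lemma matching_entry_compatible s F : sound s F ->
  {in core s, forall v, (v \in F) = (v \in I)} ->
  all (nonadj (trace (parent s))) [seq v <- F | v \notin ocore (parent s)].
Proof.
move=> [_ sF stF] FI; apply/all_nonadjP=> x v.
rewrite mem_trace mem_ocore => /and3P[xI x_up xb] vF'; apply/negP=> xv.
have x_below := strictly_below_neighbour fdD (strictly_below_filter sF vF') xv.
have xF : x \in F by rewrite FI // mem_core xb andbT; apply: below_obag fdD _ _ x_below x_up.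
have vF : v \in F by move: vF'; rewrite mem_filter => /andP[].
by have := stableP _ stF x v xF vF; rewrite xv.
Qed.

Lemma size_entry_split s F : {subset F <= below s} ->
  size [seq v <- F | v \notin ocore (parent s)] =
  size [seq v <- F | (v \notin ocore (parent s)) && (v \in core s)] +
  size [seq v <- F | v \notin core s].
Proof.
move=> sF; set F' := filter _ F.
rewrite -(count_predC (mem (core s)) F') !size_filter !count_filter.
congr addn; first by apply: eq_count => v; rewrite /= andbC.
apply: eq_in_count => v /sF v_below /=; apply/andb_idr; apply: contra.
rewrite mem_ocore mem_core => /andP[v_up ->]; rewrite andbT.
exact: below_obag fdD _ _ v_below v_up.
Qed.

Lemma card_trace_core s F : uniq F ->
  {in core s, forall v, (v \in F) = (v \in I)} ->
  #|I :&: ((bag s :\: base D) :\: obag (parent s))| <=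
  size [seq v <- F | (v \notin ocore (parent s)) && (v \in core s)].
Proof.
move=> uF FI; rewrite -(card_uniqP (filter_uniq _ uF)) subset_leq_card //.
apply/subsetP=> v; rewrite !inE => /and4P[vI v_up vb vs].
have vc : v \in core s by rewrite mem_core vs.
by rewrite mem_filter vc FI // vI mem_ocore (negPf v_up).
Qed.

Lemma best_entry_matches i s F : F \in table i s -> matches i s F ->
  frac_leq a #|I :&: (reach i s :\: obag (parent s))|
    (size (best_entry (trace (parent s)) (ocore (parent s)) (table i s))).
Proof.
move=> Ftb [FI le_F]; have sndF := table_sound Ftb; have [uF sF _] := sndF.
set F' := [seq v <- F | v \notin ocore (parent s)].
apply: (@frac_leq_transr _ _ (size F')); last first.
  by apply: size_longest; rewrite mem_filter matching_entry_compatible // map_f.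
pose J := I :&: ((bag s :\: base D) :\: obag (parent s)).
pose R := I :&: (reach i s :\: (bag s :\: base D)).
apply: (@frac_leq_transl _ a_ge0 _ (#|J| + #|R|)).
  rewrite -[leqRHS]cardsUI; apply: leq_trans (leq_addr _ _).
  apply/subset_leq_card/subsetP=> v; rewrite !inE.
  by case: (v \in I); case: (v \in obag _); case: (v \in bag s); case: (v \in base D);
    case: (v \in reach i s).
rewrite size_entry_split //; apply: frac_leqD le_F.
exact/(frac_leqW a_le1)/card_trace_core.
Qed.

Definition matched i s : Prop := i = 0 \/ exists2 F, F \in table i s & matches i s F.

Lemma children_solution_matches i o : (forall s, parent s = o -> matched i s) ->
  frac_leq a (\sum_(s | parent s == o) #|I :&: (reach i s :\: obag o)|)
    (size (children_solution i o (trace o))).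
Proof.
move=> matched_i; rewrite children_solutionE size_flatten sumnE !big_map.
rewrite big_filter big_enum_cond; apply: frac_leq_sum => s /eqP par_s.
have [->|[F Ftb mF]] := matched_i s par_s.
  by rewrite /= set0D setI0 cards0; apply: frac_leq0.
by have := best_entry_matches Ftb mF; rewrite par_s.
Qed.

Lemma card_reachS i t :
  #|I :&: (reach i.+1 t :\: (bag t :\: base D))| <=
  #|I :&: (bag t :&: base D)| + \sum_(s | parent s == Some t) #|I :&: (reach i s :\: bag t)|.
Proof.
pose W := \bigcup_(s | parent s == Some t) (I :&: (reach i s :\: bag t)).
apply: (@leq_trans #|(I :&: (bag t :&: base D)) :|: W|); last first.
  rewrite cardsU; apply: leq_trans (leq_subr _ _) _; rewrite leq_add2l.
  exact: card_bigcup_leq.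
apply/subset_leq_card/subsetP=> v; rewrite !inE.
case/and3P=> vI + /orP[vt|/bigcupP[s par_s vs]].
  by rewrite vI vt andbT negbK /= => ->.
have [vt|vt _] := boolP (v \in bag t); first by rewrite vI andbT negbK /= => ->.
by apply/orP; right; apply/bigcupP; exists s => //; rewrite !inE vI vt.
Qed.

Lemma extend_trace_matches i t (X := trace (Some t)) : (forall s, matched i s) ->
  matches i.+1 t
    (X ++ sol [seq v <- base_part t | nonadj X v] ++ children_solution i (Some t) X).
Proof.
move=> matched_i; set U := filter _ (base_part t).
have sU v : (v \in U) = [&& nonadj X v, v \in bag t & v \in base D].
  by rewrite mem_filter mem_base_part.
have [uS sS _ _] := base_oracle t X.
have [_ sK _ _] := children_solution_sound (Some t) X (@table_sound i).
have notin_core v : v \in sol U ++ children_solution i (Some t) X -> v \notin core t.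
  rewrite mem_cat mem_core => /orP[/sS|/sK/below_children_below/andP[/negPf-> //]].
  by rewrite mem_base_part => /andP[_ ->]; rewrite andbF.
split=> [v vt|].
  by rewrite mem_cat (contraTF (@notin_core v)) ?orbF ?negbK // mem_trace vt andbT.
have -> : [seq v <- X ++ sol U ++ children_solution i (Some t) X | v \notin core t] =
    sol U ++ children_solution i (Some t) X.
  rewrite filter_cat (all_filterP (introT allP notin_core)).
  rewrite (@eq_in_filter _ _ pred0 X) ?filter_pred0 // => v.
  by rewrite mem_trace => /andP[_ ->].
rewrite size_cat; apply: (frac_leq_transl a_ge0 (card_reachS i t)).
apply: frac_leqD; last by apply: (@children_solution_matches i (Some t)) => s _.
have [|_ _ _] := @solP t U (filter_uniq _ (uniq_base_part t)).
  by move=> v; rewrite mem_filter => /andP[].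
apply=> [|v]; first by apply/independentP=> x y /setIP[xI _] /setIP[yI _];
  apply: (independentP _ indI).
rewrite !inE sU => /and3P[vI -> ->]; rewrite !andbT.
by apply/nonadjP=> x; rewrite mem_trace => /andP[xI _]; apply: (independentP _ indI).
Qed.

Lemma table_matches i s : matched i s.
Proof.
elim: i s => [|i IHi] s; [by left | right].
exists (extend (states i) s (trace (Some s))); last exact: extend_trace_matches.
by apply: map_f; rewrite mem_filter stable_trace; apply: filter_subseqs.
Qed.
End Completeness.

Lemma reach_climb k r t : climb k r = Some t -> bag r \subset reach k.+1 t.
Proof.
elim: k t => [|k IHk] t; first by case=> ->; apply: subsetUl.
rewrite climbS; case def_s: (climb k r) => [s|] //= par_s.
apply: subset_trans (IHk s def_s) _; rewrite subsetU //; apply/orP; right.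
by apply: (bigcup_sup s); first exact/eqP.
Qed.

Lemma reach_leq i j t : i <= j -> reach i t \subset reach j t.
Proof.
elim: i j t => [|i IHi] [|j] t //= le_ij; first exact: sub0set.
apply: setUS; apply/bigcupsP=> s par_s; apply: subset_trans (IHi j s le_ij) _.
exact: (bigcup_sup s).
Qed.

Lemma reach_roots v : exists2 s : D, parent s = None & v \in reach #|D| s.
Proof.
have [r vr] := fd_cover fdD v; have [s root_s /ancestorP[k up_k]] := root_above r.
exists s => //; apply: (subsetP (reach_leq s (climb_lt_card up_k))).
exact: (subsetP (reach_climb up_k)).
Qed.

Lemma dp_solution_approx : approx_in a predT dp_solution.
Proof.
have [uK _ stK _] := children_solution_sound None [::] (@table_sound #|D|).
split=> // I indI _.
have := children_solution_matches (fun s (_ : parent s = None) => table_matches indI #|D| s).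
apply: frac_leq_transl => //; apply: leq_trans (card_bigcup_leq _ _).
apply/subset_leq_card/subsetP=> v vI; have [s root_s vs] := reach_roots v.
by apply/bigcupP; exists s; [exact/eqP | rewrite !inE vI].
Qed.
End DynamicProgram.

(** * Programs on graphs *)

Definition Adj : term := program (fn M x y => Nth $ (Nth $ M $ x) $ y).
Definition Nonadj : term := program
  (fn M X v => All $ (fn x => Not $ (Adj $ M $ x $ v)) $ X).
Definition All_nonadj : term := program
  (fn M X Y => All $ (fn v => Nonadj $ M $ X $ v) $ Y).
Definition Filter_nonadj : term := program
  (fn M X Y => Filter $ (fn v => Nonadj $ M $ X $ v) $ Y).
Definition Subgraph : term := program
  (fn M U => Map $ (fn x => Map $ (fn y => Adj $ M $ x $ y) $ U) $ U).

Definition adj_time N := nth_time N + nth_time N + 10.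
Definition nonadj_time N := list_time N (adj_time N + 10) + 10.
Definition nonadj_list_time N := list_time N (nonadj_time N + 10) + 10.
Definition subgraph_time N := list_time N (list_time N (adj_time N + 10) + 10) + 10.

Lemma value_graph (G : sgraph) : is_value (enc_graph G).
Proof. by rewrite /enc_graph; value_tac. Qed.
#[export] Hint Resolve value_graph : val.

Section ListGraph.
Variables (G : sgraph) (U : seq G).

Definition list_edge : rel 'I_(size U) :=
  fun i j => edge (tnth (in_tuple U) i) (tnth (in_tuple U) j).

Lemma list_edge_sym : symmetric list_edge.
Proof. by move=> i j; apply: edge_sym. Qed.

Lemma list_edge_irr : irreflexive list_edge.
Proof. by move=> i; apply: edge_irr. Qed.

(* The subgraph induced by U, with the vertices numbered by their position. *)
Definition list_graph : sgraph := SGraph list_edge_sym list_edge_irr.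

Lemma enc_list_graph : enc_graph list_graph =
  enc_list (fun x => enc_list (fun y => enc_bool (edge x y)) U) U.
Proof.
have enc_positions (e : G -> term) :
    enc_list e U = enc_list (fun i => e (tnth (in_tuple U) i)) (enum 'I_(size U)).
  by rewrite -(enc_list_map e (tnth (in_tuple U))) map_tnth_enum.
by rewrite enc_positions; apply: eq_enc_list => i; rewrite enc_positions.
Qed.

Lemma approx_in_list_graph a (s : seq list_graph) : (0 <= a)%R -> uniq U ->
  approximates a s -> approx_in a [in U] (map (tnth (in_tuple U)) s).
Proof.
move=> a_ge0 uU [uniq_s ind_s opt_s]; pose tU := tnth (in_tuple U).
have inj_tU : injective tU by apply/tuple_uniqP.
split.
- by rewrite map_inj_uniq.
- by move=> _ /mapP[i _ ->]; apply: (mem_tnth i (in_tuple U)).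
- apply/stableP=> _ _ /mapP[i is_ ->] /mapP[j js ->].
  by move: ind_s; rewrite independent_stable => /stableP/(_ i j is_ js).
move=> I indI sIU; rewrite size_map; apply: frac_leq_transl opt_s => //.
pose J := [set i : list_graph | tU i \in I].
have indJ : independent J.
  by apply/independentP=> i j; rewrite !inE; apply: (independentP _ indI).
apply: leq_trans (leq_bigmax_cond _ indJ).
rewrite -(card_imset _ inj_tU); apply/subset_leq_card/subsetP=> v vI.
have /tnthP[i def_v] : v \in in_tuple U by apply: sIU.
by apply/imsetP; exists i; rewrite // inE /tU -def_v.
Qed.
End ListGraph.

Section GraphPrograms.
Variables (G : sgraph) (N : nat).
Hypothesis leGN : #|G| <= N.
Implicit Types X Y U : seq G.
Local Notation M := (enc_graph G).

Lemma adj_runs (x y : G) :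
  runs (Adj M (enc_elt x) (enc_elt y)) (adj_time N) (enc_bool (edge x y)).
Proof.
execute Adj.
  rewrite /enc_graph.
  call (nth_enum_runs leGN (e := fun x => enc_list (fun y => enc_bool (edge x y)) _) x).
  by finish (nth_enum_runs leGN (e := fun y => enc_bool (edge x y)) y).
by rewrite /adj_time; lia.
Qed.
#[local] Opaque Adj.

Lemma nonadj_runs X (v : G) : size X <= N ->
  runs (Nonadj M (enc_elts X) (enc_elt v)) (nonadj_time N) (enc_bool (nonadj X v)).
Proof.
move=> leN; execute Nonadj.
  finish (all_runs (p := fun x => ~~ edge x v) (K := adj_time N + 10)) => x _.
  by execute; [call adj_runs; apply: not_runs | lia].
by rewrite /nonadj_time; lia.
Qed.
#[local] Opaque Nonadj.

Lemma all_nonadj_runs X Y : size X <= N -> size Y <= N ->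
  runs (All_nonadj M (enc_elts X) (enc_elts Y)) (nonadj_list_time N)
    (enc_bool (all (nonadj X) Y)).
Proof.
move=> leX leY; execute All_nonadj.
  finish (all_runs (K := nonadj_time N + 10)) => v _.
  by execute; [finish nonadj_runs | lia].
by rewrite /nonadj_list_time; lia.
Qed.

Lemma filter_nonadj_runs X Y : size X <= N -> size Y <= N ->
  runs (Filter_nonadj M (enc_elts X) (enc_elts Y)) (nonadj_list_time N)
    (enc_elts [seq v <- Y | nonadj X v]).
Proof.
move=> leX leY; execute Filter_nonadj.
  finish (filter_runs (K := nonadj_time N + 10)) => v _.
  by execute; [finish nonadj_runs | lia].
by rewrite /nonadj_list_time; lia.
Qed.

Lemma subgraph_runs U : size U <= N ->
  runs (Subgraph M (enc_elts U)) (subgraph_time N) (enc_graph (list_graph U)).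
Proof.
move=> leN; rewrite enc_list_graph; execute Subgraph.
  finish (map_enc_runs (K := list_time N (adj_time N + 10) + 10)) => x _.
  execute.
    finish (map_enc_runs (K := adj_time N + 10)) => y _.
    by execute; [finish adj_runs | lia].
  by lia.
by rewrite /subgraph_time; lia.
Qed.
End GraphPrograms.
#[global] Opaque Adj Nonadj All_nonadj Filter_nonadj Subgraph.

(** * The dynamic program in the lambda-calculus *)

(* In these programs a node is ((i, p), (B, P)), where i is its number, p the
   number of its parent, and B and P are its core and base part. *)

Definition Best_entry : term := program (fn M X B tb =>
  Longest $ (Filter $ (fn F => All_nonadj $ M $ X $ F)
                    $ (Map $ (fn F => Remove $ B $ F) $ tb))).
Definition Best_entries : term := program (fn M X B sts =>
  Flatten $ (Map $ (fn st => st $ (fn nd tb => Best_entry $ M $ X $ B $ tb)) $ sts)).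
Definition Children : term := program (fn o sts =>
  Filter $ (fn st => st $ (fn nd tb => nd $ (fn ip bs => ip $ (fn i p =>
    Eq_option $ o $ p)))) $ sts).
Definition Extend (S : term) : term := program (fn M e ch B P X =>
  Cat $ X $ (Cat $ (S $ M $ e $ (Filter_nonadj $ M $ X $ P))
                 $ (Best_entries $ M $ X $ B $ ch))).
Definition Update (S : term) : term := program (fn M e sts st =>
  st $ (fn nd tb => nd $ (fn ip bs => ip $ (fn i p => bs $ (fn B P =>
    (fn ch => Pair $ nd $ (Map $ (fn X => Extend S $ M $ e $ ch $ B $ P $ X)
       $ (Filter $ (fn X => All_nonadj $ M $ X $ X) $ (Subseqs $ B))))
    $ (Children $ (Just $ i) $ sts)))))).
Definition Init_node : term := program (fn nodes base i =>
  (Nth $ nodes $ i) $ (fn p bg =>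
    Pair $ (Pair $ i $ p) $ (Pair $ (Remove $ base $ bg) $ (Restrict $ base $ bg)))).
Definition Init : term := program (fn nodes base =>
  Map $ (fn i => Pair $ (Init_node $ nodes $ base $ i) $ Nil) $ (Indices $ nodes)).
Definition Dp_solution (S : term) : term := program (fn M D e =>
  D $ (fn nodes base =>
    Best_entries $ M $ Nil $ Nil $ (Children $ enc_option enc_nat None
      $ (Foldr $ (fn x sts => Map $ (fn st => Update S $ M $ e $ sts $ st) $ sts)
           $ (Init $ nodes $ base) $ nodes)))).

Lemma value_Extend S : is_value S -> is_value (Extend S).
Proof. by move=> vS; rewrite /Extend; expose; value_tac. Qed.
#[export] Hint Resolve value_Extend : val.

Lemma value_Update S : is_value S -> is_value (Update S).
Proof. by move=> vS; rewrite /Update; expose; value_tac. Qed.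
#[export] Hint Resolve value_Update : val.

Lemma value_Dp_solution S : is_value S -> is_value (Dp_solution S).
Proof. by move=> vS; rewrite /Dp_solution; expose; value_tac. Qed.
#[export] Hint Resolve value_Dp_solution : val.

Lemma value_set (T : finType) (A : {set T}) : is_value (enc_set A).
Proof. by rewrite /enc_set; value_tac. Qed.
#[export] Hint Resolve value_set : val.

Lemma value_decomposition (G : sgraph) (D : decomposition G) :
  is_value (enc_decomposition D).
Proof. by rewrite /enc_decomposition; value_tac. Qed.
#[export] Hint Resolve value_decomposition : val.

Definition best_entry_time N :=
  list_time N (restrict_time N + 10) + list_time N (nonadj_list_time N + 10)
  + longest_time N + 20.
Definition best_entries_time N :=
  list_time N (best_entry_time N + 10) + flatten_time N + 20.
Definition children_time N := list_time N (eqn_time N + 40) + 10.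
Definition extend_time N K :=
  K + nonadj_list_time N + best_entries_time N + cat_time N + cat_time N + 20.
Definition update_time N K :=
  list_time N (extend_time N K + 10) + list_time N (nonadj_list_time N + 10)
  + subseqs_time N + children_time N + 60.
Definition init_node_time N := nth_time N + restrict_time N + restrict_time N + 40.
Definition init_time N := list_time N (init_node_time N + 10) + indices_time N + 20.
Definition dp_time N K :=
  best_entries_time N + children_time N + init_time N
  + loop_time N (list_time N (update_time N K + 10) + 10) + 40.

Definition enc_entry (G : sgraph) (D : decomposition G) (t : D) : term :=
  enc_pair (enc_option (@enc_elt D) (parent t)) (enc_set (bag t)).

Lemma value_entry (G : sgraph) (D : decomposition G) (t : D) : is_value (enc_entry t).
Proof. by apply: value_pair; value_tac. Qed.
#[export] Hint Resolve value_entry : val.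

Lemma enc_entryE (G : sgraph) (D : decomposition G) (t : D) : enc_entry t =
  enc_pair (enc_option (@enc_elt D) (parent t)) (enc_elts (enum (bag t))).
Proof. by []. Qed.

Lemma enc_decompositionE (G : sgraph) (D : decomposition G) : enc_decomposition D =
  enc_pair (enc_list (@enc_entry G D) (enum D)) (enc_elts (enum (base D))).
Proof. by []. Qed.
#[global] Opaque enc_entry.

Section DynamicProgramRuns.
Variables (G : sgraph) (D : decomposition G) (N : nat).
Hypotheses (leGN : #|G| <= N) (leDN : #|D| <= N).
Implicit Types (X B F : seq G) (t : D) (tb : seq (seq G)) (sts : seq (D * seq (seq G))).
Local Notation M := (enc_graph G).
Local Notation eL := (enc_list (@enc_elt G)).
Local Notation eO := (enc_option (@enc_elt D)).

Definition enc_node t : term :=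
  enc_pair (enc_pair (enc_elt t) (eO (parent t))) (enc_pair (eL (core t)) (eL (base_part t))).
Definition enc_state (st : D * seq (seq G)) : term :=
  enc_pair (enc_node st.1) (enc_list eL st.2).

Lemma value_node t : is_value (enc_node t).
Proof. by rewrite /enc_node; value_tac. Qed.
#[local] Hint Resolve value_node : val.

Lemma value_state st : is_value (enc_state st).
Proof. by rewrite /enc_state; value_tac. Qed.
#[local] Hint Resolve value_state : val.

Lemma enc_nodeE t : enc_node t =
  enc_pair (enc_pair (enc_elt t) (eO (parent t))) (enc_pair (eL (core t)) (eL (base_part t))).
Proof. by []. Qed.

Lemma enc_stateE st : enc_state st = enc_pair (enc_node st.1) (enc_list eL st.2).
Proof. by []. Qed.
#[local] Opaque enc_node enc_state.

Definition bounded tb : bool := (size tb <= N) && all (fun F => size F <= N) tb.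

Lemma best_entry_runs X B tb : size X <= N -> size B <= N -> bounded tb ->
  runs (Best_entry M (eL X) (eL B) (enc_list eL tb))
    (best_entry_time N) (eL (best_entry X B tb)).
Proof.
move=> leX leB /andP[leT /allP leF]; execute Best_entry.
  call (map_runs (eY := eL) (g := fun F => [seq v <- F | v \notin B])
    (K := restrict_time N + 10)).
    by move=> F /leF le_F; execute; [finish (remove_runs leGN) | lia].
  call (filter_runs (p := fun F => all (nonadj X) F) (K := nonadj_list_time N + 10) (N := N)).
      by rewrite size_map.
    move=> _ /mapP[F /leF le_F ->]; execute.
      by finish (all_nonadj_runs leGN); apply: leq_trans (size_filter_leq _ _) le_F.
    by lia.
  finish (longest_runs (N := N)).
    by apply: leq_trans (size_filter_leq _ _) _; rewrite size_map.
  apply/allP=> F; rewrite mem_filter => /andP[_ /mapP[F' /leF le_F ->]].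
  exact: leq_trans (size_filter_leq _ _) le_F.
by rewrite /best_entry_time; lia.
Qed.
#[local] Opaque Best_entry.

Lemma best_entries_runs X B sts : size X <= N -> size B <= N -> size sts <= N ->
  {in sts, forall st, bounded st.2} ->
  runs (Best_entries M (eL X) (eL B) (enc_list enc_state sts))
    (best_entries_time N) (eL (best_entries X B sts)).
Proof.
move=> leX leB leN bst; execute Best_entries.
  call (map_runs (eY := eL) (g := fun st => best_entry X B st.2)
    (K := best_entry_time N + 10)).
    move=> st /bst b_st; execute.
      by rewrite enc_stateE; step steps_pair; finish best_entry_runs.
    by lia.
  finish (flatten_runs (N := N)); first by rewrite size_map.
  apply/allP=> _ /mapP[st /bst/andP[_ /allP leF] ->].
  case: (best_entryP X B st.2) => [-> //|[F /leF le_F [-> _]]].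
  exact: leq_trans (size_filter_leq _ _) le_F.
by rewrite /best_entries_time; lia.
Qed.
#[local] Opaque Best_entries.

Lemma children_runs o sts : size sts <= N ->
  runs (Children (eO o) (enc_list enc_state sts)) (children_time N)
    (enc_list enc_state (children o sts)).
Proof.
move=> leN; execute Children.
  finish (filter_runs (p := fun st => parent st.1 == o) (K := eqn_time N + 40)) => st _.
  execute.
    rewrite enc_stateE; step steps_pair; rewrite enc_nodeE; step steps_pair; step steps_pair.
    by finish eq_option_runs.
  by lia.
by rewrite /children_time; lia.
Qed.
#[local] Opaque Children.

Lemma size_children o sts : size sts <= N -> size (children o sts) <= N.
Proof. exact/leq_trans/size_filter_leq. Qed.

Lemma sub_children o sts : {subset children o sts <= sts}.
Proof. exact/mem_subseq/filter_subseq. Qed.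

Variables (S e : term) (sol : seq G -> seq G) (K : nat).
Hypotheses (vS : is_value S) (ve : is_value e).
Hypothesis sol_runs : forall (t : D) U, uniq U -> {subset U <= base_part t} ->
  size (sol U) <= N /\ runs (S M e (eL U)) K (eL (sol U)).
Hypothesis leCN : forall t : D, 2 ^ size (core t) <= N.

Lemma size_core_leq t : size (core t) <= N.
Proof. exact: size_uniq_leq (uniq_core t). Qed.

Lemma extend_runs sts t X : size X <= N -> size sts <= N ->
  {in sts, forall st, bounded st.2} ->
  runs (Extend S M e (enc_list enc_state (children (Some t) sts))
      (eL (core t)) (eL (base_part t)) (eL X))
    (extend_time N K) (eL (extend sol sts t X)).
Proof.
move=> leX leN bst; set U := [seq v <- base_part t | nonadj X v].
have [leS rS] : size (sol U) <= N /\ runs (S M e (eL U)) K (eL (sol U)).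
  apply: (sol_runs (t := t)); first exact/filter_uniq/uniq_base_part.
  by move=> v; rewrite mem_filter => /andP[].
execute Extend.
  call (filter_nonadj_runs leGN (X := X) (Y := base_part t) leX).
    exact: size_uniq_leq (uniq_base_part t).
  call rS; call (@best_entries_runs X (core t) (children (Some t) sts)).
  - exact: size_core_leq.
  - exact: size_children.
  - by move=> st /sub_children/bst.
  by call (cat_runs (l1 := sol U) _ (N := N)); finish (cat_runs (l1 := X) _ (N := N)).
by rewrite /extend_time; lia.
Qed.
#[local] Opaque Extend.

Lemma update_runs sts t tb : size sts <= N -> {in sts, forall st, bounded st.2} ->
  runs (Update S M e (enc_list enc_state sts) (enc_state (t, tb)))
    (update_time N K) (enc_state (t, update sol sts t)).
Proof.
move=> leN bst.
have leX X : X \in subseqs (core t) -> size X <= N.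
  by move=> /mem_subseqs/size_subseq/leq_trans; apply; apply: size_core_leq.
execute Update.
  rewrite (enc_stateE (t, tb)); step steps_pair.
  rewrite {1}enc_nodeE; step steps_pair; step steps_pair; step steps_pair.
  call (just_runs (e := @enc_elt D) t); call (@children_runs (Some t)).
  call (subseqs_runs (eX := @enc_elt G) (N := N)); first exact: size_core_leq.
  call (filter_runs (p := fun X => stable X) (K := nonadj_list_time N + 10) (N := N)).
      by rewrite size_subseqs.
    by move=> X /leX le_X; execute; [finish (all_nonadj_runs leGN) | lia].
  call (map_runs (eY := eL) (g := extend sol sts t) (K := extend_time N K + 10) (N := N)).
      by apply: leq_trans (size_filter_leq _ _) _; rewrite size_subseqs.
    move=> X; rewrite mem_filter => /andP[_ /leX le_X].
    by execute; [finish extend_runs | lia].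
  by finish pair_runs.
by rewrite /update_time; lia.
Qed.
#[local] Opaque Update.

Lemma init_node_runs t :
  runs (Init_node (enc_list (@enc_entry G D) (enum D))
      (enc_elts (enum (base D))) (enc_elt t))
    (init_node_time N) (enc_node t).
Proof.
have leE (A : {set G}) : size (enum A) <= N := size_enum_leq A leGN.
execute Init_node.
  call (nth_enum_runs leDN (e := @enc_entry G D) t); rewrite enc_entryE; step steps_pair.
  call (restrict_runs leGN (l := enum (base D)) (s := enum (bag t))).
  call (remove_runs leGN (l := enum (base D)) (s := enum (bag t))).
  rewrite (eq_filter (mem_enum (base D))) (eq_filter (_ : _ =1 [predC base D])); last first.
    by move=> v; rewrite /= mem_enum.
  call pair_runs; call pair_runs; rewrite enc_nodeE.
  by finish pair_runs.
by rewrite /init_node_time; lia.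
Qed.
#[local] Opaque Init_node.

Lemma init_runs :
  runs (Init (enc_list (@enc_entry G D) (enum D)) (enc_elts (enum (base D))))
    (init_time N) (enc_list enc_state (states D sol 0)).
Proof.
execute Init.
  call (enum_runs leDN (e := @enc_entry G D)).
  finish (map_runs (eY := enc_state) (g := fun t => (t, [::])) (K := init_node_time N + 10)
    (N := N)).
    by rewrite -cardE.
  move=> t _; execute.
    by call init_node_runs; rewrite (enc_nil eL) enc_stateE; finish pair_runs.
  by lia.
by rewrite /init_time; lia.
Qed.
#[local] Opaque Init.

Hypothesis bounded_table : forall i (t : D), bounded (table sol i t).

Lemma dp_solution_runs :
  runs (Dp_solution S M (enc_decomposition D) e) (dp_time N K) (eL (dp_solution D sol)).
Proof.
have leE : size (enum D) <= N by rewrite -cardE.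
have bst i : {in states D sol i, forall st, bounded st.2}.
  by move=> _ /mapP[t _ ->]; apply: bounded_table.
have leN i : size (states D sol i) <= N by rewrite size_map.
pose round (sts : seq (D * seq (seq G))) := [seq (st.1, update sol sts st.1) | st <- sts].
have statesE (l : seq D) : foldr (fun=> round) (states D sol 0) l = states D sol (size l).
  by elim: l => //= t l ->; rewrite /round update_states.
execute Dp_solution.
  rewrite enc_decompositionE; step steps_pair; call init_runs.
  call (foldr_runs_suffix (g := fun=> round) (K := list_time N (update_time N K + 10) + 10)
    (N := N)).
    move=> l1 t l2 eqD; rewrite statesE /round; execute.
      finish (map_runs (K := update_time N K + 10) (N := N)) => -[s tb] _.
      by execute; [finish update_runs | lia].
    by lia.
  rewrite statesE -cardE (enc_none _ (@enc_elt D)); call (@children_runs None).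
  rewrite {1 2}(enc_nil (@enc_elt G)); apply: best_entries_runs => //.
    exact: size_children.
  by move=> st /sub_children/bst.
by rewrite /dp_time; lia.
Qed.
End DynamicProgramRuns.
#[global] Opaque Dp_solution.

(** * Polynomial bounds *)

Lemma leq_expl m n e : m <= n -> m ^ e <= n ^ e.
Proof. by case: e => // e le_mn; rewrite leq_exp2r. Qed.

Definition poly_bounded (T : nat -> nat) : Prop := exists c, forall n, T n <= n.+2 ^ c.

Lemma poly_const m : poly_bounded (fun=> m).
Proof.
by exists m => n; apply: leq_trans (ltnW (ltn_expl m (ltnSn 1))) (leq_expl _ _).
Qed.

Lemma poly_id : poly_bounded (fun n => n).
Proof. by exists 1 => n; rewrite expn1; lia. Qed.

Lemma poly_add f g : poly_bounded f -> poly_bounded g -> poly_bounded (fun n => f n + g n).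
Proof.
move=> [c fP] [d gP]; exists (c + d).+1 => n; rewrite expnS expnD.
have := fP n; have := gP n.
have : 0 < n.+2 ^ c by rewrite expn_gt0.
have : 0 < n.+2 ^ d by rewrite expn_gt0.
by nia.
Qed.

Lemma poly_mul f g : poly_bounded f -> poly_bounded g -> poly_bounded (fun n => f n * g n).
Proof. by move=> [c fP] [d gP]; exists (c + d) => n; rewrite expnD leq_mul. Qed.

Lemma poly_exp f c : poly_bounded f -> poly_bounded (fun n => f n ^ c).
Proof. by move=> [d fP]; exists (d * c) => n; rewrite expnM leq_expl. Qed.

Lemma poly_bounded_leq T : poly_bounded T -> exists c, forall n, 1 < n -> T n <= n ^ c.
Proof.
move=> [c TP]; exists (2 * c) => n n_gt1; apply: leq_trans (TP n) _.
by rewrite expnM leq_expl // expnS expn1; nia.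
Qed.

Ltac poly_tac :=
  lazymatch goal with
  | |- poly_bounded (fun n => n) => exact: poly_id
  | |- poly_bounded (fun n => @?f n + @?g n) => apply: (@poly_add f g); poly_tac
  | |- poly_bounded (fun n => @?f n * @?g n) => apply: (@poly_mul f g); poly_tac
  | |- poly_bounded (fun n => @?f n ^ ?c) => apply: (@poly_exp f c); poly_tac
  | |- poly_bounded (fun _ => ?m) => exact: (poly_const m)
  | |- poly_bounded (fun n => ?T (@?f n) (@?g n)) => unfold T; poly_tac
  | |- poly_bounded (fun n => ?T (@?f n)) => first [assumption | unfold T; poly_tac]
  | |- poly_bounded ?T => unfold T; poly_tac
  end.

(** * Approximation schemes *)

Lemma family_embedding (H : graph_family) (G1 G2 : sgraph) (f : G2 -> G1) :
  well_behaved H -> injective f -> (forall x y, edge (f x) (f y) = edge x y) ->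
  H G1 -> H G2.
Proof.
move=> [Hiso Hher _] inj_f edge_f HG1.
pose A := [set f x | x : G2]; have fA x : f x \in A by apply: imset_f.
apply: (Hiso (induced A)); last exact: Hher.
pose g (x : G2) : induced A := exist _ (f x) (fA x).
have inj_g : injective g by move=> x y /(congr1 val) /inj_f.
have [h gK hK] : bijective g.
  apply: inj_card_bij => //; rewrite card_sig -(card_imset predT inj_f).
  by apply/subset_leq_card/subsetP=> x; rewrite inE.
exists h; first by exists g.
by move=> x y; rewrite -edge_f -[edge x y]/(edge (val x) (val y)) -{2}[x]hK -{2}[y]hK.
Qed.

Lemma family_induced_subset (H : graph_family) (G : sgraph) (A B : {set G}) :
  well_behaved H -> B \subset A -> H (induced A) -> H (induced B).
Proof.
move=> hH sBA; pose f (x : induced B) : induced A := exist _ (val x) (subsetP sBA _ (valP x)).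
by apply: (@family_embedding H _ _ f) => // x y /(congr1 val) /= /val_inj.
Qed.

Lemma value_rat q : is_value (enc_rat q).
Proof. by rewrite /enc_rat; value_tac. Qed.
#[export] Hint Resolve value_rat : val.

Lemma tsize_list_leq T (e : T -> term) l m :
  (forall x, tsize (e x) <= m) -> tsize (enc_list e l) <= size l * (m + 5) + 4.
Proof.
move=> le_m; rewrite tsize_list leq_add2r; elim: l => [|x l IHl].
  by rewrite big_nil.
by rewrite big_cons mulSn leq_add // leq_add2r.
Qed.

Lemma size_leq_tsize T (e : T -> term) l : size l <= tsize (enc_list e l).
Proof. by rewrite tsize_list; elim: l => [|x l IHl] //; rewrite big_cons /=; lia. Qed.

Definition graph_size n := n * (n * 9 + 4 + 5) + 4.

Lemma tsize_graph (G : sgraph) N : #|G| <= N -> tsize (enc_graph G) <= graph_size N.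
Proof.
move=> leGN; have leE : size (enum G) <= N by rewrite -cardE.
have tsize_row x : tsize (enc_list (fun y : G => enc_bool (edge x y)) (enum G)) <= N * 9 + 4.
  apply: leq_trans (@tsize_list_leq _ _ _ 4 _) _ => [y|]; first exact: tsize_bool.
  by rewrite leq_add2r leq_mul2r leE orbT.
by apply: leq_trans (tsize_list_leq _ tsize_row) _; rewrite leq_add2r leq_mul2r leE orbT.
Qed.

Lemma card_graph_leq_tsize (G : sgraph) : #|G| <= tsize (enc_graph G).
Proof. by rewrite cardE; apply: size_leq_tsize. Qed.

Lemma tsize_graph_gt1 (G : sgraph) : 1 < tsize (enc_graph G).
Proof. by rewrite tsize_list; lia. Qed.

Definition computable_in_eps (f : rat -> nat) : Prop :=
  exists2 F : term, closed_term F & forall eps, is_eps eps ->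
    exists k, evals (F (enc_rat eps)) k (enc_nat (f eps)).

Lemma computable_in_eps_succ f p :
  computable_bound f -> computable_in_eps (fun eps => (f p eps).+1).
Proof.
case=> F cF FP; pose Bound := program (fn e => Succ $ (F $ enc_nat p $ e)).
exists Bound; first by apply: value_closed; rewrite /Bound; expose; value_tac.
move=> eps eps01; have [k /evals_runs rF] := FP p eps eps01.
have [K [k' _ ev]] : exists K, runs (Bound (enc_rat eps)) K (enc_nat (f p eps).+1).
  by eexists; execute Bound; [call rF; apply: succ_runs | exact: leqnn].
by exists k'.
Qed.

Lemma computable_bound_exp f d :
  computable_in_eps f -> computable_bound (fun p eps => (2 ^ p.+1 * (f eps).+1) ^ d).
Proof.
case=> F cF FP; pose Bound := program (fn p e => Exp
  $ (Mul $ (Exp $ enc_nat 2 $ (Succ $ p)) $ (Succ $ (F $ e))) $ enc_nat d).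
exists Bound; first by apply: value_closed; rewrite /Bound; expose; value_tac.
move=> p eps eps01; have [k /evals_runs rF] := FP eps eps01.
have [K1 pow_runs] := exp_runs 2 p.+1.
have [K2 out_runs] := exp_runs (2 ^ p.+1 * (f eps).+1) d.
have [K [k' _ ev]] : exists K, runs (Bound (enc_nat p) (enc_rat eps)) K
    (enc_nat ((2 ^ p.+1 * (f eps).+1) ^ d)).
  eexists; execute Bound; last exact: leqnn.
  call rF; call (succ_runs (f eps)); call (succ_runs p); call pow_runs.
  by call (mul_runs (2 ^ p.+1) (f eps).+1); exact: out_runs.
by exists k'.
Qed.

Definition approximates_on (H : graph_family) (A : term) (f : rat -> nat) (c : nat) : Prop :=
  forall (G : sgraph) eps, H G -> is_eps eps -> exists2 s : seq G,
    runs (A (enc_graph G) (enc_rat eps)) (f eps * tsize (enc_graph G) ^ c) (enc_elts s)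
    & approximates (1 - eps)%R s.

Definition independent_set_eptas (H : graph_family) : Prop :=
  exists (A : term) (f : rat -> nat) (c : nat),
    [/\ closed_term A, computable_in_eps f & approximates_on H A f c].

Lemma independent_set_fptasP (P : parameter) : independent_set_fptas P <->
  exists (A : term) (f : nat -> rat -> nat) (c : nat),
    [/\ closed_term A, computable_bound f &
      forall (G : sgraph) (w : witness P G) p eps,
        param_value P G p -> wvalid w -> wmeasure w = p -> is_eps eps ->
        exists2 s : seq G,
          runs (A (enc_graph G) (enc_witness w) (enc_rat eps))
            (f p eps * (tsize (enc_graph G) + tsize (enc_witness w)) ^ c) (enc_elts s)
          & approximates (1 - eps)%R s].
Proof.
split=> -[A [f [c [cA cf AP]]]]; exists A, f, c; split=> // G w p eps pG valw mw eps01.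
  have [k [s [ev le_k us is_ le_s]]] := AP G w p eps pG valw mw eps01.
  by exists s; [exists k | split].
have [s [k le_k ev] [us is_ le_s]] := AP G w p eps pG valw mw eps01.
by exists k, s; split.
Qed.

(* Optimality of the witness is never an issue since its measure is 0. *)
Lemma eptas_of_fptas (H : graph_family) (P : parameter) (W : term) (T : nat -> nat) :
  (forall G, value_encoding (@enc_witness P G)) -> is_value W -> poly_bounded T ->
  (forall G, H G -> exists w : witness P G,
     [/\ wvalid w, wmeasure w = 0 & forall N, #|G| <= N ->
         tsize (enc_witness w) <= T N /\ runs (W (enc_graph G)) (T N) (enc_witness w)]) ->
  independent_set_fptas P -> independent_set_eptas H.
Proof.
move=> value_witness vW pT WP /independent_set_fptasP[A [f [c [cA cf AP]]]].
have [d leT] : exists d, forall n, 1 < n -> (n + T n) ^ c + T n + 20 <= n ^ d.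
  by apply: poly_bounded_leq; poly_tac.
pose Restricted := program (fn M e => A $ M $ (W $ M) $ e).
exists Restricted, (fun eps => (f 0 eps).+1), d; split.
- by apply: value_closed; rewrite /Restricted; expose; value_tac.
- exact: computable_in_eps_succ.
move=> G eps HG eps01; have [w [valw mw Ww]] := WP G HG.
have w_opt : param_value P G 0 by split=> //; exists w.
have [s rA s_opt] := AP G w 0 eps w_opt valw mw eps01; exists s => //.
set n := tsize (enc_graph G) in rA *.
have [sz_w rW] := Ww n (card_graph_leq_tsize G).
execute Restricted; first by call rW; exact: rA.
have : f 0 eps * (n + tsize (enc_witness w)) ^ c <= f 0 eps * (n + T n) ^ c.
  by rewrite leq_mul // leq_expl // leq_add2l.
by have := leT n (tsize_graph_gt1 G); nia.
Qed.

Definition Solve (A : term) : term := program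
  (fn M e U => Map $ (fn i => Nth $ U $ i) $ (A $ (Subgraph $ M $ U) $ e)).

Definition solve_time N K := subgraph_time N + K + list_time N (nth_time N + 10) + 10.

Lemma value_Solve A : closed_term A -> is_value (Solve A).
Proof. by move=> cA; rewrite /Solve; expose; value_tac. Qed.

Lemma solve_runs A (G : sgraph) (U : seq G) e (s : seq (list_graph U)) K N :
  closed_term A -> is_value e -> #|G| <= N -> size U <= N -> size s <= N ->
  runs (A (enc_graph (list_graph U)) e) K (enc_elts s) ->
  runs (Solve A (enc_graph G) e (enc_elts U))
    (solve_time N K) (enc_elts (map (tnth (in_tuple U)) s)).
Proof.
move=> cA ve leGN leU les rA; execute Solve.
  call (subgraph_runs leGN leU); call rA.
  finish (map_runs (eY := @enc_elt G) (K := nth_time N + 10)) => i _.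
  execute.
    rewrite enc_eltE enum_rank_ord (tnth_nth (tnth (in_tuple U) i)).
    by finish nth_runs.
  by lia.
by rewrite /solve_time; lia.
Qed.
#[global] Opaque Solve.

Lemma onem_eps_ge0 eps : is_eps eps -> (0 <= 1 - eps)%R.
Proof. by case/andP=> _ lt_eps1; rewrite subr_ge0 ltW. Qed.

Lemma onem_eps_le1 eps : is_eps eps -> (1 - eps <= 1)%R.
Proof. by case/andP=> gt_eps0 _; rewrite lerBlDr lerDl ltW. Qed.

Section SchemeOnDecompositions.
Variables (H : graph_family) (A : term) (f : rat -> nat) (c : nat).
Hypotheses (hH : well_behaved H) (cA : closed_term A).
Hypothesis A_approx : approximates_on H A f c.

Definition Scheme : term := Dp_solution (Solve A).
Definition oracle_time n := solve_time n (n * graph_size n ^ c).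
Definition scheme_time n := dp_time n (oracle_time n).

Lemma value_Scheme : is_value Scheme.
Proof. exact/value_Dp_solution/value_Solve. Qed.

Variables (G : sgraph) (D : decomposition G) (eps : rat) (N : nat).
Hypotheses (fdD : is_forest_decomposition H D) (eps01 : is_eps eps).
Hypotheses (leGN : #|G| <= N) (leDN : #|D| <= N) (lefN : f eps <= N).

Definition solves (U s : seq G) : Prop :=
  runs (Solve A (enc_graph G) (enc_rat eps) (enc_elts U))
    (oracle_time N) (enc_elts s) /\ approx_in (1 - eps)%R [in U] s.

Lemma list_graph_family (t : D) (U : seq G) :
  uniq U -> {subset U <= base_part t} -> H (list_graph U).
Proof.
move=> uU sU; pose tU := tnth (in_tuple U).
have memU i : tU i \in bag t :&: base D.
  by rewrite inE -mem_base_part sU // (mem_tnth i (in_tuple U)).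
pose g (i : list_graph U) : induced (bag t :&: base D) := exist _ (tU i) (memU i).
apply: (@family_embedding H _ _ g) (fd_family fdD t) => // i j /(congr1 val).
by apply: (tuple_uniqP (in_tuple U) uU).
Qed.

Lemma base_part_solvable (t : D) (U : seq G) :
  uniq U -> {subset U <= base_part t} -> exists s, solves U s.
Proof.
move=> uU sU; have [s rA s_opt] := A_approx (list_graph_family uU sU) eps01.
have leU : size U <= N := size_uniq_leq leGN uU.
exists (map (tnth (in_tuple U)) s); split; last first.
  exact: approx_in_list_graph (onem_eps_ge0 eps01) uU s_opt.
have [us _ _] := s_opt.
have les : size s <= N by apply: size_uniq_leq us; rewrite card_ord.
apply: runs_leq (solve_runs cA (value_rat eps) leGN leU les rA) _.
rewrite /oracle_time /solve_time !leq_add2r leq_add2l leq_mul // leq_expl //.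
by apply: tsize_graph; rewrite card_ord.
Qed.

Lemma oracle_exists : exists sol : seq G -> seq G, forall (t : D) U,
  uniq U -> {subset U <= base_part t} -> solves U (sol U).
Proof.
pose in_base U := exists2 t : D, uniq U & {subset U <= base_part t}.
have [U|sol solP] := @functional_choice _ _ (fun U s => in_base U -> solves U s).
  have [[t uU sU]|not_in_base] := classic (in_base U); last by exists [::].
  by have [s sP] := base_part_solvable uU sU; exists s.
by exists sol => t U uU sU; apply: solP; exists t.
Qed.

Lemma scheme_runs p : width D <= p -> 2 ^ p.+1 <= N ->
  exists2 s : seq G,
    runs (Scheme (enc_graph G) (enc_decomposition D) (enc_rat eps))
         (scheme_time N) (enc_elts s)
    & approximates (1 - eps)%R s.
Proof.
move=> /width_leqP le_core le2N; have [sol solP] := oracle_exists.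
have sol_approx t U uU sU := (solP t U uU sU).2.
exists (dp_solution D sol).
  have le2C (t : D) : 2 ^ size (core t) <= N.
    by apply: leq_trans le2N; rewrite size_core leq_exp2l.
  apply: (dp_solution_runs leGN leDN (value_Solve cA) (value_rat eps) _ le2C).
    move=> t U uU sU; have [rS [uS _ _ _]] := solP t U uU sU.
    by split=> //; apply: size_uniq_leq uS.
  move=> i t; rewrite /bounded (leq_trans (size_table _ _ _) (le2C t)) /=; apply/allP=> F.
  by move/(table_sound fdD sol_approx)=> [uF _ _]; apply: size_uniq_leq uF.
apply/approx_in_approximates.
exact: dp_solution_approx fdD (onem_eps_ge0 eps01) (onem_eps_le1 eps01) sol_approx.
Qed.
End SchemeOnDecompositions.

Lemma fptas_of_eptas (H : graph_family) (P : parameter) (W : term) (T : nat -> nat) :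
  well_behaved H -> (forall G, value_encoding (@enc_witness P G)) ->
  is_value W -> poly_bounded T ->
  (forall G (w : witness P G), wvalid w -> exists D : decomposition G,
     [/\ is_forest_decomposition H D, width D <= wmeasure w,
         #|D| <= tsize (enc_witness w)
       & forall N, #|G| <= N -> tsize (enc_witness w) <= N ->
           runs (W (enc_graph G) (enc_witness w)) (T N) (enc_decomposition D)]) ->
  independent_set_eptas H -> independent_set_fptas P.
Proof.
move=> hH value_witness vW pT WP [A [f [c [cA cf A_approx]]]]; apply/independent_set_fptasP.
have [d leT] : exists d, forall n, 1 < n -> scheme_time c n + T n + 20 <= n ^ d.
  by apply: poly_bounded_leq; poly_tac.
have vScheme := value_Scheme cA.
pose Lifted := program (fn M w e => Scheme A $ M $ (W $ M $ w) $ e).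
exists Lifted, (fun p eps => (2 ^ p.+1 * (f eps).+1) ^ d), d; split.
- by apply: value_closed; rewrite /Lifted; expose; value_tac.
- exact: computable_bound_exp.
move=> G w p eps _ valw mw eps01; have [D [fdD width_D leD rW]] := WP G w valw.
rewrite {}mw in width_D; set n := tsize (enc_graph G) + tsize (enc_witness w).
have n_gt1 : 1 < n by apply: leq_trans (tsize_graph_gt1 G) (leq_addr _ _).
pose m := 2 ^ p.+1 * (f eps).+1; pose N := n * m.
have m_gt0 : 0 < m by rewrite muln_gt0 expn_gt0.
have le_mN : m <= N by rewrite leq_pmull // ltnW.
have le_nN : n <= N by rewrite leq_pmulr.
have leGN : #|G| <= N.
  by apply: leq_trans le_nN; apply: leq_trans (card_graph_leq_tsize G) (leq_addr _ _).
have lewN : tsize (enc_witness w) <= N by apply: leq_trans (leq_addl _ _) le_nN.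
have le2N : 2 ^ p.+1 <= N by apply: leq_trans le_mN; rewrite leq_pmulr.
have lefN : f eps <= N.
  by apply: leq_trans le_mN; apply: leq_trans (leqnSn _) _; rewrite leq_pmull ?expn_gt0.
have [s rS s_opt] :=
  scheme_runs hH cA A_approx fdD eps01 leGN (leq_trans leD lewN) lefN width_D le2N.
exists s => //; execute Lifted; first by call (rW N leGN lewN); exact: rS.
have := leT N (leq_trans n_gt1 le_nN); rewrite -expnMn mulnC -/N.
by apply: leq_trans; lia.
Qed.

(** * Modulators *)

Lemma filter_enum (T : finType) (A : {set T}) : [seq x <- enum T | x \in A] = enum A.
Proof. by rewrite enumT; apply: eq_filter. Qed.

Lemma enum_graph_runs (G : sgraph) N : #|G| <= N ->
  runs (Indices (enc_graph G)) (indices_time N) (enc_elts (enum G)).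
Proof. by move=> leGN; rewrite /enc_graph; finish enum_runs. Qed.

Definition trivial_forest : forest :=
  @Forest unit (fun=> None) (fun t => ex_intro _ 1 (erefl None)).

Definition mod_decomposition (G : sgraph) (S : {set G}) : decomposition G :=
  @Decomposition G trivial_forest (fun=> setT) (~: S).

Lemma trivial_leaf (t : trivial_forest) : is_leaf t.
Proof. exact/forallP. Qed.

Lemma mod_decomposition_tree (H : graph_family) (G : sgraph) (S : {set G}) :
  is_modulator H S -> is_tree_decomposition H (mod_decomposition S).
Proof.
move=> modS; split=> /= [|v|u v _|v _|t _].
- by apply/cards1P; exists tt; apply/setP=> -[]; rewrite !inE /is_root !eqxx.
- split; first by exists tt; rewrite inE.
  by move=> [] [] _ _; apply: connect0.
- by exists tt; rewrite !inE.
- by exists tt; [exact: trivial_leaf | case; rewrite inE].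
by rewrite setTI.
Qed.

Lemma mod_decomposition_elim (H : graph_family) (G : sgraph) : well_behaved H -> H G ->
  is_elim_decomposition H (mod_decomposition (set0 : {set G})).
Proof.
case=> _ Hher _ HG; split=> /= [t|v|t _|v _|u v [] [] _ _ _].
- by rewrite trivial_leaf.
- by exists tt; split=> [|[] //]; rewrite inE.
- by rewrite setC0 subsetT; split=> //; apply: Hher.
- by exists tt; split=> [|[] //]; rewrite inE trivial_leaf.
by rewrite ancestor_refl.
Qed.

Lemma depth_mod_decomposition (G : sgraph) (S : {set G}) : depth (mod_decomposition S) = 0.
Proof.
apply/eqP; rewrite -leqn0; apply/bigmax_leqP=> -[] _.
by rewrite leqn0 cards_eq0; apply/eqP/setP=> -[]; rewrite !inE eqxx andbF.
Qed.

Lemma width_mod_decomposition (G : sgraph) (S : {set G}) :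
  width (mod_decomposition S) <= #|S|.
Proof. by apply/width_leqP=> t; rewrite setTD setCK. Qed.

Definition Mod_decomposition : term := program (fn M S =>
  Pair $ (Cons $ (Pair $ enc_option enc_nat None $ (Indices $ M)) $ Nil)
       $ (Remove $ S $ (Indices $ M))).

Definition mod_time N := indices_time N + indices_time N + restrict_time N + 20.

Lemma enc_mod_decomposition (G : sgraph) (S : {set G}) :
  enc_decomposition (mod_decomposition S) =
  enc_pair (enc_list (@enc_entry G (mod_decomposition S)) [:: tt]) (enc_elts (enum (~: S))).
Proof. by rewrite enc_decompositionE enumT unlock. Qed.

Lemma mod_decomposition_runs (G : sgraph) (S : {set G}) N : #|G| <= N ->
  runs (Mod_decomposition (enc_graph G) (enc_set S)) (mod_time N)
    (enc_decomposition (mod_decomposition S)).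
Proof.
have entryE : enc_pair (enc_option (@enc_elt trivial_forest) None) (enc_elts (enum G)) =
    enc_entry (tt : mod_decomposition S).
  by rewrite enc_entryE /= enum_setT -enumT.
move=> leGN; rewrite enc_mod_decomposition; execute Mod_decomposition.
  call (enum_graph_runs leGN); call (enum_graph_runs leGN); rewrite /enc_set.
  call (remove_runs leGN (l := enum S) (s := enum G)).
      exact: size_enum_leq.
    by rewrite -cardE.
  rewrite (eq_filter (_ : _ =1 [in ~: S])) ?filter_enum => [|v]; last first.
    by rewrite !inE mem_enum.
  rewrite (enc_none _ (@enc_elt trivial_forest)); call pair_runs; rewrite entryE.
  by rewrite (enc_nil (@enc_entry G (mod_decomposition S))); call cons_runs; finish pair_runs.
by rewrite /mod_time; lia.
Qed.
#[global] Opaque Mod_decomposition.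

Definition set_size n := n * (4 * n + 4 + 5) + 4.

Lemma tsize_set (T : finType) (A : {set T}) N : #|T| <= N -> tsize (enc_set A) <= set_size N.
Proof.
move=> leN; apply: leq_trans (tsize_list_leq _ (m := 4 * N + 4) _) _ => [x|].
  rewrite enc_eltE tsize_nat leq_add2r leq_mul2l.
  exact: leq_trans (ltnW (ltn_ord _)) leN.
by rewrite leq_add2r leq_mul2r size_enum_leq ?orbT.
Qed.

Lemma tsize_mod_decomposition (G : sgraph) (S : {set G}) N : #|G| <= N ->
  tsize (enc_decomposition (mod_decomposition S)) <= set_size N + set_size N + 40.
Proof.
move=> leGN; rewrite enc_mod_decomposition tsize_pair tsize_list big_cons big_nil.
rewrite enc_entryE tsize_pair tsize_none.
have := tsize_set [set: G] leGN; have := tsize_set (~: S) leGN; rewrite /enc_set /=; lia.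
Qed.

Lemma card_decomposition (G : sgraph) (D : decomposition G) :
  #|D| <= tsize (enc_decomposition D).
Proof.
rewrite tsize_pair cardE.
by apply: leq_trans (leq_trans (leq_addr _ _) (leq_addr _ _)); apply: size_leq_tsize.
Qed.

(** * Tree and elimination decompositions *)

Lemma tree_forest_decomposition (H : graph_family) (G : sgraph) (D : decomposition G) :
  well_behaved H -> is_tree_decomposition H D -> is_forest_decomposition H D.
Proof.
move=> hH [_ connD edgeD baseD leafD]; split=> // [v|v|v s t vb|t].
- by have [] := connD v.
- by have [] := connD v.
- by have [l _ bagE] := baseD v vb; rewrite !bagE => /eqP-> /eqP->.
have [leaf_t|leafN] := boolP (is_leaf t); first exact: leafD.
have [l leaf_l _] := leaf_below t.
apply: family_induced_subset (leafD l leaf_l) => //; apply/subsetP=> v.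
rewrite inE => /andP[vt vb]; have [l' leaf_l' bagE] := baseD v vb.
by move: vt leafN; rewrite bagE => /eqP->; rewrite leaf_l'.
Qed.

Section ElimDecomposition.
Variables (G : sgraph) (D : decomposition G).

Definition path_bag (t : D) : {set G} := \bigcup_(a : D | ancestor a t) bag a.

Definition path_decomposition : decomposition G :=
  @Decomposition G (dforest D) path_bag (base D).

Lemma path_bagP (t : D) v :
  reflect (exists2 a : D, ancestor a t & v \in bag a) (v \in path_bag t).
Proof. exact: bigcupP. Qed.

Section ForestDecomposition.
Variables (H : graph_family).
Hypotheses (hH : well_behaved H) (elimD : is_elim_decomposition H D).

Lemma elim_bag_uniq v (s t : D) : v \in bag s -> v \in bag t -> s = t.
Proof.
have [_ uD _ _ _] := elimD; have [r [_ r_uniq]] := uD v.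
by move=> /r_uniq <- /r_uniq.
Qed.

Lemma elim_base_leaf v (t : D) : v \in base D -> v \in bag t -> is_leaf t.
Proof.
have [_ _ _ bD _] := elimD; move=> /bD[l [[leaf_l vl] _]] vt.
by rewrite (elim_bag_uniq vt vl).
Qed.

Lemma path_bag_base v (t : D) : v \in base D -> v \in path_bag t -> v \in bag t.
Proof.
move=> vb /path_bagP[a anc_a va].
by rewrite (leaf_descendant (elim_base_leaf vb va) anc_a).
Qed.

Lemma path_bag_nodes v (a : D) : v \in bag a ->
  [set t : D | v \in path_bag t] = [set t : D | ancestor a t].
Proof.
move=> va; apply/setP=> t; rewrite !inE; apply/path_bagP/idP => [[b anc_b vb]|anc_a].
  by rewrite (elim_bag_uniq va vb).
by exists a.
Qed.

Lemma path_decomposition_forest : is_forest_decomposition H path_decomposition.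
Proof.
have [_ uD leafD _ edgeD] := elimD.
have own v (t : D) : v \in bag t -> v \in path_bag t.
  by move=> vt; apply/path_bagP; exists t; first exact: ancestor_refl.
split=> /= [v|v|u v uv|v s t vb /(path_bag_base vb) vs /(path_bag_base vb)|t].
- by have [t [vt _]] := uD v; exists t; apply: own.
- have [a [va _]] := uD v; rewrite (path_bag_nodes va).
  exact: connected_descendants.
- have [s [us _]] := uD u; have [t [vt _]] := uD v.
  have /orP[anc|anc] := edgeD u v s t uv us vt; [exists t | exists s].
    by split; [apply/path_bagP; exists s | apply: own].
  by split; [apply: own | apply/path_bagP; exists t].
- exact: elim_bag_uniq.
have [l leaf_l _] := leaf_below t; have [leaf_t|leafN] := boolP (is_leaf t).
  apply: family_induced_subset (proj2 (leafD t leaf_t)) => //; apply/subsetP=> v.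
  by rewrite inE => /andP[vt vb]; apply: path_bag_base.
apply: family_induced_subset (proj2 (leafD l leaf_l)) => //; apply/subsetP=> v.
rewrite inE => /andP[vt vb]; case/negP: leafN.
exact: elim_base_leaf vb (path_bag_base vb vt).
Qed.

(* A vertex outside the base is determined by its node, an ancestor of t. *)
Lemma width_path_decomposition : width path_decomposition <= depth D.
Proof.
have [internalD _ leafD _ _] := elimD; apply/width_leqP=> t /=.
apply: leq_trans (_ : _ <= (node_depth t).+1) _; last by rewrite ltnS node_depth_leq.
have -> : (node_depth t).+1 = #|[set a : D | ancestor a t]|.
  rewrite (cardsD1 t) !inE ancestor_refl add1n; congr _.+1.
  by apply: eq_card => a; rewrite !inE andbC.
pose home v : D := odflt t [pick a : D | v \in bag a].
have homeP v (a : D) : v \in bag a -> home v = a.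
  by rewrite /home => va; case: pickP => [b vb|/(_ a)/idP[]//]; exact: (elim_bag_uniq vb va).
have inj_home : {in path_bag t :\: base D &, injective home}.
  move=> u v /setDP[/path_bagP[a _ ua] ub] /setDP[/path_bagP[b _ vb] _].
  rewrite (homeP u a ua) (homeP v b vb) => eq_ab; rewrite -{b}eq_ab in vb.
  have leafN : ~~ is_leaf a by apply: contra ub => /leafD[/subsetP sub _]; apply: sub.
  have [/card_le1_eqP le1 _] := internalD a leafN.
  exact: le1.
rewrite -(card_in_imset inj_home); apply/subset_leq_card/subsetP=> _ /imsetP[v + ->].
by case/setDP=> /path_bagP[b anc_b vb] _; rewrite inE (homeP v b vb).
Qed.
End ForestDecomposition.

Lemma path_bag_rec (t : D) :
  path_bag t = bag t :|: (if parent t is Some s then path_bag s else set0).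
Proof.
apply/setP=> v; rewrite inE; apply/path_bagP/orP => [[a /ancestor_cases]|].
  by case=> [->|[s -> anc_a]] va; [left | right; apply/path_bagP; exists a].
case=> [vt|]; first by exists t; first exact: ancestor_refl.
case par_t: (parent t) => [s|]; last by rewrite inE.
case/path_bagP=> a anc_a va; exists a => //.
exact: ancestor_trans anc_a (ancestor_parent par_t).
Qed.

Definition climb_step (q : option D * seq G) : option D * seq G :=
  if q.1 is Some t then (parent t, enum (bag t) ++ q.2) else q.

Lemma mem_iter_climb_step k (t : D) l v : climb k t = None ->
  (v \in (iter k climb_step (Some t, l)).2) = (v \in l) || (v \in path_bag t).
Proof.
elim: k t l => // k IHk t l; rewrite climbSr iterSr path_bag_rec {2}/climb_step /=.
case: (parent t) => [s /= /IHk->|_]; first by rewrite mem_cat mem_enum inE orbCA orbA.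
by rewrite iter_fix //= mem_cat mem_enum setU0 orbC.
Qed.

Lemma path_bag_climb (t : D) : (iter #|D| climb_step (Some t, [::])).2 =i path_bag t.
Proof.
move=> v; rewrite mem_iter_climb_step //; have [k le_k up_k] := climb_leq_card t.
by rewrite -(subnK le_k) climbD up_k.
Qed.

Lemma size_iter_climb_step k q N : #|G| <= N ->
  size (iter k climb_step q).2 <= k * N + size q.2.
Proof.
move=> leGN; elim: k => //= k; rewrite {2}/climb_step; case: (iter k _ _) => -[t|] l /= IHk.
  by rewrite size_cat mulSn -addnA leq_add ?size_enum_leq.
by apply: leq_trans IHk _; rewrite mulSn -addnA leq_addl.
Qed.
End ElimDecomposition.

Definition Path_bag : term := program (fn nodes i =>
  (Foldr $ (fn x q => q $ (fn o l =>
      o $ (fn j => (Nth $ nodes $ j) $ (fn p b => Pair $ p $ (Cat $ b $ l))) $ q))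
    $ (Pair $ (Just $ i) $ Nil) $ nodes) $ (fn o l => l)).
Definition Path_decomposition : term := program (fn M D => D $ (fn nodes base =>
  Pair $ (Map $ (fn i => (Nth $ nodes $ i) $ (fn p b =>
      Pair $ p $ (Restrict $ (Path_bag $ nodes $ i) $ (Indices $ M)))) $ (Indices $ nodes))
    $ base)).

Definition path_bag_time N := loop_time N (nth_time N + cat_time N + 20) + 20.
Definition path_time N :=
  list_time N (nth_time N + path_bag_time N + indices_time N + restrict_time (N * N) + 40)
  + indices_time N + 40.

Section PathDecompositionRuns.
Variables (G : sgraph) (D : decomposition G) (N : nat).
Hypotheses (leGN : #|G| <= N) (leDN : #|D| <= N).
Local Notation eL := (enc_list (@enc_elt G)).
Local Notation eO := (enc_option (@enc_elt D)).
Local Notation nodes := (enc_list (@enc_entry G D) (enum D)).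

Definition enc_climb (q : option D * seq G) : term := enc_pair (eO q.1) (eL q.2).

Lemma value_climb q : is_value (enc_climb q).
Proof. by rewrite /enc_climb; value_tac. Qed.
#[local] Hint Resolve value_climb : val.

Lemma enc_climbE q : enc_climb q = enc_pair (eO q.1) (eL q.2).
Proof. by []. Qed.
#[local] Opaque enc_climb.

Lemma path_bag_runs (t : D) :
  runs (Path_bag nodes (enc_elt t)) (path_bag_time N)
    (eL (iter #|D| (@climb_step G D) (Some t, [::])).2).
Proof.
execute Path_bag.
  call (just_runs (e := @enc_elt D) t); rewrite (enc_nil (@enc_elt G)); call pair_runs.
  rewrite -(enc_climbE (Some t, [::])).
  call (foldr_runs (eY := enc_climb) (g := fun=> @climb_step G D)
    (K := nth_time N + cat_time N + 20) (N := N)).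
      by rewrite -cardE.
    move=> x [[j|] l] _; rewrite {1}enc_climbE; execute.
    + step steps_pair; step steps_some; call (nth_enum_runs leDN (e := @enc_entry G D) j).
      rewrite enc_entryE; step steps_pair.
      call (cat_runs (l1 := enum (bag j)) l (N := N)); first exact: size_enum_leq.
      by rewrite enc_climbE; finish pair_runs.
    + by lia.
    + by rewrite {1}enc_climbE; step steps_pair; step steps_none; ret.
    by lia.
  have -> : foldr (fun=> @climb_step G D) (Some t, [::]) (enum D) =
      iter #|D| (@climb_step G D) (Some t, [::]).
    by rewrite cardE; elim: (enum D) => //= x l ->.
  by rewrite enc_climbE; step steps_pair; ret.
by rewrite /path_bag_time; lia.
Qed.
#[local] Opaque Path_bag.

Lemma path_decomposition_runs :
  runs (Path_decomposition (enc_graph G) (enc_decomposition D)) (path_time N)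
    (enc_decomposition (path_decomposition D)).
Proof.
have leN2 : N <= N * N by case: (N) => // n; rewrite leq_pmulr.
rewrite !enc_decompositionE; execute Path_decomposition.
  step steps_pair; call (enum_runs leDN (e := @enc_entry G D)).
  call (map_enc_runs (e := @enc_entry G (path_decomposition D))
    (K := nth_time N + path_bag_time N + indices_time N + restrict_time (N * N) + 40)
    (N := N)).
      by rewrite -cardE.
    move=> t _; execute.
      call (nth_enum_runs leDN (e := @enc_entry G D) t); rewrite enc_entryE; step steps_pair.
      call (enum_graph_runs leGN); call (path_bag_runs t).
      call (restrict_runs (leq_trans leGN leN2)
        (l := (iter #|D| (@climb_step G D) (Some t, [::])).2) (s := enum G)).
      - apply: leq_trans (size_iter_climb_step _ _ leGN) _.
        by rewrite addn0 leq_mul2r leDN orbT.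
      - by rewrite -cardE (leq_trans leGN).
      rewrite (eq_filter (@path_bag_climb G D t)) filter_enum enc_entryE.
      by finish pair_runs.
    by lia.
  by finish pair_runs.
by rewrite /path_time; lia.
Qed.
End PathDecompositionRuns.
#[global] Opaque Path_bag Path_decomposition.

Section SchemeEquivalences.
Variable H : graph_family.
Hypothesis hH : well_behaved H.

Lemma eptas_of_mod_fptas :
  independent_set_fptas (mod_param H) -> independent_set_eptas H.
Proof.
apply: (@eptas_of_fptas H (mod_param H) (program (fn M => Nil)) (fun=> 4)) => //.
- by move=> G S; apply: value_set.
- exact: poly_const.
move=> G HG; exists (set0 : {set G}); split=> [||N _] /=.
- by have [_ Hher _] := hH; apply: Hher.
- exact: cards0.
rewrite /enc_set enum_set0 tsize_list big_nil -enc_nil; split=> //.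
by expose; execute; first ret.
Qed.

Lemma eptas_of_decomposition_fptas (P : parameter) :
  (forall G, value_encoding (@enc_witness P G)) ->
  (forall G, H G -> exists2 w : witness P G, wvalid w /\ wmeasure w = 0 &
     enc_witness w = enc_decomposition (mod_decomposition (set0 : {set G}))) ->
  independent_set_fptas P -> independent_set_eptas H.
Proof.
move=> value_witness wP.
apply: (@eptas_of_fptas H P (program (fn M => Mod_decomposition $ M $ Nil))
  (fun n => mod_time n + set_size n + set_size n + 40)) => //; first by poly_tac.
move=> G HG; have [w [valw mw] enc_w] := wP G HG; exists w; rewrite enc_w; split=> // N leGN.
have := tsize_mod_decomposition set0 leGN; have := mod_decomposition_runs set0 leGN.
rewrite {1}/enc_set enum_set0 -enc_nil => rD sz_D; split; first by lia.
by expose; execute; [exact: rD | lia].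
Qed.

Lemma mod_fptas_iff_eptas :
  independent_set_fptas (mod_param H) <-> independent_set_eptas H.
Proof.
split; first exact: eptas_of_mod_fptas.
apply: (@fptas_of_eptas H (mod_param H) Mod_decomposition mod_time) => //.
- by move=> G S; apply: value_set.
- by poly_tac.
move=> G S modS; exists (mod_decomposition S); split.
- exact/tree_forest_decomposition/mod_decomposition_tree.
- exact: width_mod_decomposition.
- by rewrite card_unit /= tsize_list; lia.
by move=> N leGN _; apply: mod_decomposition_runs.
Qed.

Lemma ed_fptas_iff_eptas :
  independent_set_fptas (ed_param H) <-> independent_set_eptas H.
Proof.
have value_ed G (D : witness (ed_param H) G) : is_value (enc_witness D).
  exact: value_decomposition.
split.
  apply: eptas_of_decomposition_fptas => // G HG; exists (mod_decomposition set0) => //.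
  by split; [exact: mod_decomposition_elim | exact: depth_mod_decomposition].
apply: (@fptas_of_eptas H (ed_param H) Path_decomposition path_time) => //.
  by poly_tac.
move=> G D elimD; exists (path_decomposition D); split.
- exact: path_decomposition_forest.
- exact: width_path_decomposition elimD.
- exact: card_decomposition.
move=> N leGN leDN; apply: path_decomposition_runs => //.
exact: leq_trans (card_decomposition D) leDN.
Qed.

Lemma tw_fptas_iff_eptas :
  independent_set_fptas (tw_param H) <-> independent_set_eptas H.
Proof.
have value_tw G (D : witness (tw_param H) G) : is_value (enc_witness D).
  exact: value_decomposition.
split.
  apply: eptas_of_decomposition_fptas => // G HG; exists (mod_decomposition set0) => //.
  split; last by apply/eqP; rewrite -leqn0 -(cards0 G); apply: width_mod_decomposition.
  apply: mod_decomposition_tree; have [_ Hher _] := hH; exact: Hher.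
apply: (@fptas_of_eptas H (tw_param H) (program (fn M D => D)) (fun=> 2)) => //.
  exact: poly_const.
move=> G D treeD; exists D; split=> //.
- exact: tree_forest_decomposition.
- exact: card_decomposition.
by move=> N _ _; expose; execute; first ret.
Qed.
End SchemeEquivalences.

Theorem theorem6 (H : graph_family) (hH : well_behaved H) :
  (independent_set_fptas (mod_param H) <-> independent_set_fptas (ed_param H)) /\
  (independent_set_fptas (ed_param H) <-> independent_set_fptas (tw_param H)).
Proof.
have modE := mod_fptas_iff_eptas hH; have edE := ed_fptas_iff_eptas hH.
by have twE := tw_fptas_iff_eptas hH; tauto.
Qed.
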